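(* Let $A=(a_1,b_1,c_1,d_1)$ and $B=(a_2,b_2,c_2,d_2)$ be real matrix parameters with $a_1d_1-b_1c_1=1$, $a_2d_2-b_2c_2=1$, $b_1\neq0$, $b_2\neq0$. Let $f,g\in L^2(\mathbb{R})$ be nonzero such that $uL_A^f(u),\,uL_B^f(u),\,uL_A^g(u),\,uL_B^g(u)\in L^2(\mathbb{R})$. Then the frequency spreads of the STLCTs $S^A_gf$ and $S^B_gf$ satisfy $$F^2_{A,S}\,F^2_{B,S}\ \ge\ \frac{(a_1b_2-a_2b_1)^2}{4}.$$
   Context: For a real matrix parameter $M=(a,b,c,d)$ with $ad-bc=1$ and $b\neq0$, the LCT of $h\in L^2(\mathbb{R})$ is $L_M^{h}(u)=\int h(t)K_M(t,u)\,dt$ with $K_M(t,u)=\frac{1}{\sqrt{i2\pi b}}\exp\!\big(i\frac{a}{2b}t^2-i\frac{1}{b}tu+i\frac{d}{2b}u^2\big)$. For a window $g\in L^2(\mathbb{R})$, the STLCT of $f$ with parameter $M$ is $S^{M}_{g}f(t,u)=\int f(\tau)\overline{g(\tau-t)}K_M(\tau,u)\,d\tau$. With $\|S\|^2=\iint|S^M_gf(t,u)|^2dt\,du$, the mean frequency is $\overline{u_{M,S}}=\frac{1}{\|S\|^2}\iint u|S^M_gf(t,u)|^2dt\,du$ and the frequency spread is $F^2_{M,S}=\frac{1}{\|S\|^2}\iint (u-\overline{u_{M,S}})^2|S^M_gf(t,u)|^2dt\,du$. *)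

(* Defs.v *)
From HB Require Import structures.
From mathcomp Require Import all_boot all_order all_algebra.
From mathcomp Require Import complex.
From mathcomp Require Import all_classical all_reals all_analysis.
Set Implicit Arguments. Unset Strict Implicit. Unset Printing Implicit Defensive.
Import Order.TTheory GRing.Theory Num.Theory.
Local Open Scope classical_set_scope.
Local Open Scope ring_scope.
Local Open Scope complex_scope.

Section LCT.
Variable R : realType.

Notation leb := (@lebesgue_measure R).

Definition sqmod (z : R[i]) : R := (complex.Re z) ^+ 2 + (complex.Im z) ^+ 2.

Definition expi (th : R) : R[i] := (cos th) +i* (sin th).

Definition cint (D : set R) (h : R -> R[i]) : R[i] :=
  (Rintegral leb D (fun x => complex.Re (h x))) +i*
  (Rintegral leb D (fun x => complex.Im (h x))).

Definition L2 (h : R -> R[i]) : Prop :=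
  measurable_fun setT (fun x => complex.Re (h x)) /\
  measurable_fun setT (fun x => complex.Im (h x)) /\
  (\int[leb]_x (sqmod (h x))%:E < +oo)%E.

(* LCT kernel K_M(t,u) for M = (a,b,c,d); c does not appear in the kernel.
   1/sqrt(i 2 pi b) uses the principal complex square root sqrtc. *)
Definition lct_kernel (a b d : R) (t u : R) : R[i] :=
  (sqrtc ('i * ((2 * pi * b)%:C)))^-1 *
  expi (a / (2 * b) * t ^+ 2 - t * u / b + d / (2 * b) * u ^+ 2).

Definition lct_trunc (a b d : R) (h : R -> R[i]) (n : nat) (u : R) : R[i] :=
  cint `[- (n%:R), n%:R]%classic (fun t => h t * lct_kernel a b d t u).

(* F is (a representative of) the LCT L_M^h of h in L^2(R): the L^2 limit of
   the truncated integrals (Plancherel-type definition, valid for h in L^2). *)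
Definition is_LCT (a b d : R) (h F : R -> R[i]) : Prop :=
  L2 F /\
  ((fun n : nat => \int[leb]_u (sqmod (F u - lct_trunc a b d h n u))%:E)
     @ \oo --> 0)%E.

Definition stlct (a b d : R) (g f : R -> R[i]) (t u : R) : R[i] :=
  cint setT (fun tau => f tau * (g (tau - t))^* * lct_kernel a b d tau u).

Notation leb2 := (leb \x leb)%E.

Definition stlct_energy (a b d : R) (g f : R -> R[i]) : R :=
  Rintegral leb2 setT (fun p : R * R => sqmod (stlct a b d g f p.1 p.2)).

Definition stlct_mean_freq (a b d : R) (g f : R -> R[i]) : R :=
  Rintegral leb2 setT (fun p : R * R => p.2 * sqmod (stlct a b d g f p.1 p.2))
  / stlct_energy a b d g f.

Definition stlct_freq_spread (a b d : R) (g f : R -> R[i]) : \bar R :=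
  (\int[leb2]_p
     (((p.2 - stlct_mean_freq a b d g f) ^+ 2) * sqmod (stlct a b d g f p.1 p.2))%:E
   * ((stlct_energy a b d g f)^-1)%:E)%E.

End LCT.

(* Main.v *)
Require Import Defs.
From HB Require Import structures.
From mathcomp Require Import all_boot all_order all_algebra.
From mathcomp Require Import complex.
From mathcomp Require Import all_classical all_reals all_analysis.
From mathcomp Require Import measurable_realfun ring lra.
Set Implicit Arguments. Unset Strict Implicit. Unset Printing Implicit Defensive.
Import Order.TTheory GRing.Theory Num.Theory.
Import numFieldNormedType.Exports.
Local Open Scope classical_set_scope.
Local Open Scope ring_scope.
Local Open Scope complex_scope.

(** For almost every [t] the windowed signal [h x = f x * (g (x - t))^*] lies in
    L1 and L2, and the STLCT at [t] is its LCT.  Plancherel for L1 and L2 functions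
    comes from the Poisson kernel: [expR (- `|e t|)] damps the Fourier side,
    Fubini turns it into a Poisson average of the autocorrelation of [h], and the
    autocorrelation is continuous at [0] because translations are continuous in L1.

    The uncertainty inequality for a single [h] uses no derivatives.  The operators
    [weyl a b m s], a translation followed by a chirp, are unitary and become
    multiplication by [expi (s * (u - m))] after the LCT, so by Plancherel
    [W_A(s) h - h] has squared norm at most [s ^+ 2] times the dispersion of the LCT
    of [h] around [m].  The Weyl relation
    [W_B(s) W_A(s) = expi (delta * s ^+ 2) W_A(s) W_B(s)] with
    [delta = a1 * b2 - a2 * b1] then gives, as [s] tends to [0],
    [`|delta| * ||h||^2 <= l * V_B + l^-1 * V_A] for every [l > 0].  This bound is
    linear in the dispersions, so it can be integrated over [t] before optimizing
    in [l]. *)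

(** The classical argument commutes the two unbounded frequency operators, which asks for a common
    domain for each windowed signal; the unitary groups they generate act on every square integrable
    function. The commutator is recovered from mixed second differences: the inner product of two
    increments, each of size O(s), is compared with [1 - expi (delta * s ^+ 2)], so both sides have
    order s^2 and the limit keeps exactly the factor |delta|.

    Dispersions are extended reals and may be infinite. The linear bound is then trivial, but a
    product could degenerate to 0 times infinity, which is 0 by convention. This is excluded because
    a positive energy cannot concentrate on a line u = m, a null set of the plane.

    The constant 1/4 comes from the minimum over [l] of [l * V_B + l^-1 * V_A], which is 2 sqrt(V_A
    V_B). Both spreads are normalized by the same energy ||f||^2 ||g||^2, whatever the matrix, so
    the normalization commutes with the optimization. *)

(** * Affine changes of variable for Lebesgue measure *)

Section affine_change.
Context {R : realType}.
Notation mu := (@lebesgue_measure R).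
Variables (a c : R).
Hypothesis c0 : c != 0.

Let phi : R -> measurableTypeR R := fun x => a + c * x.

Let mphi : measurable_fun setT phi.
Proof. by apply: measurable_funD => //; exact: measurable_funM. Qed.

Let phi_mu : {measure set (measurableTypeR R) -> \bar R} :=
  measure_function_pushforward__canonical__measure_function_Measure mu mphi.

Let nu : {measure set (measurableTypeR R) -> \bar R} := mscale `|c|%:nng phi_mu.

(** By uniqueness of Lebesgue measure it is enough to compare with the scaled pushforward [nu] on
    half-open intervals. For negative [c] the preimage is half-open on the other side, with the same
    length. *)
Lemma lebesgue_measure_affine (A : set R) : measurable A ->
  mu A = (`|c|%:E * mu ((fun x => (a + c * x)%R) @^-1` A))%E.
Proof.
move=> mA.
have -> : (`|c|%:E * mu ((fun x => (a + c * x)%R) @^-1` A))%E = nu A by [].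
apply: (@lebesgue_measure_unique R nu) => //.
move=> _ [[x y]] _ <-.
rewrite /nu /= /mscale /= /pushforward.
have [cp|cn] := ltP 0 c.
  have -> : phi @^-1` `]x, y] = `](x - a) / c, (y - a) / c]%classic.
    apply/seteqP; split => z /=; rewrite !in_itv/= /phi ltr_pdivrMr// ler_pdivlMr//;
    by rewrite ltrBlDl lerBrDl (mulrC z).
  rewrite !lebesgue_measure_itv/= !lte_fin ltr_pM2r ?invr_gt0// ltrD2r.
  case: ifPn => // _; last by rewrite mule0.
  rewrite -!EFinB -EFinM gtr0_norm//; congr EFin; field.
  by rewrite gt_eqF.
have cn' : c < 0 by rewrite lt_neqAle c0.
have -> : phi @^-1` `]x, y] = `[(y - a) / c, (x - a) / c[%classic.
  apply/seteqP; split => z /=; rewrite !in_itv/= /phi ltr_ndivlMr// ler_ndivrMr//;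
  by rewrite ltrBlDl lerBrDl (mulrC z) andbC.
rewrite !lebesgue_measure_itv/= !lte_fin ltr_nM2r ?invr_lt0// ltrD2r.
case: ifPn => // _; last by rewrite mule0.
rewrite -!EFinB -EFinM ltr0_norm//; congr EFin; field.
exact: c0.
Qed.

Lemma ge0_integral_affine (f : R -> \bar R) :
  measurable_fun setT f -> (forall x, 0 <= f x)%E ->
  (\int[mu]_x f x = `|c|%:E * \int[mu]_x f (a + c * x)%R)%E.
Proof.
move=> mf f0.
rewrite (eq_measure_integral nu); last first.
  by move=> A mA _; exact: lebesgue_measure_affine.
rewrite ge0_integral_mscale// ge0_integral_pushforward//.
Qed.

Lemma integrable_affine (f : R -> \bar R) :
  mu.-integrable setT f -> mu.-integrable setT (fun x => f (a + c * x)%R).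
Proof.
move=> /integrableP[mf fi]; apply/integrableP; split.
  exact: (measurableT_comp mf mphi).
move: fi; rewrite (ge0_integral_affine (f := fun x => `|f x|%E))//; last first.
  exact: measurableT_comp.
apply: contraTT; rewrite -!leNgt !leye_eq => /eqP ->.
by rewrite gt0_muley// lte_fin normr_gt0.
Qed.

Lemma Rintegral_affine (f : R -> R) : mu.-integrable setT (EFin \o f) ->
  \int[mu]_x f x = `|c| * \int[mu]_x f (a + c * x).
Proof.
move=> fi; have fi2 := integrable_affine fi.
have mf : measurable_fun setT (EFin \o f) by exact: measurable_int fi.
rewrite /Rintegral [in LHS]integralE [in RHS]integralE.
rewrite (ge0_integral_affine (measurable_funepos mf))//.
rewrite (ge0_integral_affine (measurable_funeneg mf))//.
have i1 := integrable_fin_num measurableT (integrable_funepos measurableT fi2).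
have i2 := integrable_fin_num measurableT (integrable_funeneg measurableT fi2).
have E1 : (fun x => ((EFin \o f)^\+)%E (a + c * x)) = ((fun x => (f (a + c * x)%R)%:E)^\+)%E.
  by rewrite !unlock.
have E2 : (fun x => ((EFin \o f)^\-)%E (a + c * x)) = ((fun x => (f (a + c * x)%R)%:E)^\-)%E.
  by rewrite !unlock.
rewrite E1 E2.
rewrite -muleBr//; last by apply: fin_num_adde_defl; rewrite fin_numN.
by rewrite fineM// fin_numD fin_numN i1 i2.
Qed.

End affine_change.

(** * Measurability of integrals depending on a parameter *)

Section parametric.
Context d1 d2 (T1 : measurableType d1) (T2 : measurableType d2) (R : realType).
Variable m2 : {sigma_finite_measure set T2 -> \bar R}.

(** Tonelli applies separately to the positive and negative parts, and [fine] is measurable. Points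
    whose section is not integrable are covered too: there the real integral is whatever [fine]
    returns. *)
Lemma measurable_fun_Rintegral (f : T1 * T2 -> R) : measurable_fun setT f ->
  measurable_fun setT (fun x => Rintegral m2 setT (fun y => f (x, y))).
Proof.
move=> /measurable_EFinP mf; apply: (measurableT_comp (fine_measurable measurableT)) => //.
rewrite (_ : (fun x => _) = (fun x => (\int[m2]_y ((EFin \o f)^\+ (x, y)))
   - (\int[m2]_y ((EFin \o f)^\- (x, y))))%E); last first.
  apply/funext => x; rewrite integralE.
  by congr (_ - _)%E; apply: eq_integral => y _; rewrite !unlock.
apply: emeasurable_funB.
  by apply: measurable_fun_fubini_tonelli_F => //; exact: measurable_funepos.
by apply: measurable_fun_fubini_tonelli_F => //; exact: measurable_funeneg.
Qed.
End parametric.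

Ltac mfun := repeat first
  [ assumption
  | exact: measurable_cst
  | exact: measurable_id
  | exact: measurable_fst
  | exact: measurable_snd
  | apply: measurable_funD
  | apply: measurable_funB
  | apply: measurable_funX
  | apply: measurable_funM
  | apply: measurable_funN
  | apply: (measurableT_comp (continuous_measurable_fun (@continuous_cos _)))
  | apply: (measurableT_comp (continuous_measurable_fun (@continuous_sin _)))
  | apply: (measurableT_comp (@measurable_expR _))
  | apply: (measurableT_comp (@normr_measurable _ setT)) ].

(** * Integrable real functions *)

Section L1.
Context d (T : measurableType d) (R : realType) (m : {measure set T -> \bar R}).
Implicit Types f g : T -> R.

Definition L1 f := m.-integrable setT (EFin \o f).

Lemma L1_measurable f : L1 f -> measurable_fun setT f.
Proof. by move=> /measurable_int /measurable_EFinP. Qed.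

Lemma L1_le g f : measurable_fun setT f -> L1 g ->
  (forall x, `|f x| <= g x) -> L1 f.
Proof.
move=> mf ig fg; apply: le_integrable ig => //; first exact/measurable_EFinP.
by move=> x _; rewrite lee_fin (le_trans (fg x))// ler_norm.
Qed.

Lemma eq_L1 f g : f =1 g -> L1 f -> L1 g.
Proof. by move=> /funext ->. Qed.

Lemma L1D f g : L1 f -> L1 g -> L1 (fun x => f x + g x).
Proof.
move=> fi gi; apply: (eq_integrable measurableT) (integrableD measurableT fi gi).
by [].
Qed.

Lemma L1B f g : L1 f -> L1 g -> L1 (fun x => f x - g x).
Proof.
move=> fi gi; apply: (eq_integrable measurableT) (integrableB measurableT fi gi).
by [].
Qed.

Lemma L1Z (k : R) f : L1 f -> L1 (fun x => k * f x).
Proof.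
move=> fi; apply: (eq_integrable measurableT) (integrableZl measurableT k fi).
by [].
Qed.

Lemma L1_norm f : L1 f -> L1 (fun x => `|f x|).
Proof.
by move=> fi; apply: (eq_integrable measurableT) (integrable_abse fi).
Qed.

Lemma L1_bounded_mul (k : R) f g : L1 f -> measurable_fun setT g ->
  (forall x, `|g x| <= k) -> L1 (fun x => f x * g x).
Proof.
move=> fi mg gk; apply: (@L1_le (fun x => k * `|f x|)).
- by have mf := L1_measurable fi; mfun.
- exact/L1Z/L1_norm.
- by move=> x; rewrite normrM mulrC ler_wpM2r.
Qed.

Lemma L1_ge0 f : measurable_fun setT f -> (forall x, 0 <= f x) ->
  (\int[m]_x (f x)%:E < +oo)%E -> L1 f.
Proof.
move=> mf f0 fi; apply/integrableP; split; first exact/measurable_EFinP.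
by under eq_integral do rewrite /= ger0_norm//.
Qed.

Lemma L1_fineK f : L1 f -> (\int[m]_x (f x)%:E)%E = (\int[m]_x f x)%:E.
Proof. by move=> fi; rewrite /Rintegral fineK//; exact: integrable_fin_num. Qed.

Lemma L1_indic (E : set T) f : measurable E -> m.-integrable E (EFin \o f) ->
  L1 (fun x => f x * \1_E x).
Proof.
move=> mE /(integrable_mkcond _ mE).1; apply: eq_integrable => // x _ /=.
by rewrite /patch indicE; case: ifPn => _ /=; rewrite ?mulr1 ?mulr0.
Qed.

(* AM-GM makes products of square integrable functions integrable. *)
Lemma L1_mul f g : measurable_fun setT f -> measurable_fun setT g ->
  L1 (fun x => f x ^+ 2) -> L1 (fun x => g x ^+ 2) -> L1 (fun x => f x * g x).
Proof.
move=> mf mg f2 g2; apply: (L1_le _ (L1D f2 g2)); first by mfun.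
move=> x; rewrite ler_norml; apply/andP.
have := sqr_ge0 (f x + g x); have := sqr_ge0 (f x - g x).
have := sqr_ge0 (f x); have := sqr_ge0 (g x).
rewrite !expr2; split; lra.
Qed.

End L1.

(** * Continuity of translations in L1 *)

Section translation.
Context {R : realType}.
Notation mu := (@lebesgue_measure R).
Notation L1 := (L1 mu).

Lemma L1_shift (s : R) (f : R -> R) : L1 f -> L1 (fun x => f (x + s)).
Proof.
move=> fi; apply: eq_L1 (@integrable_affine R s 1 (oner_neq0 _) _ fi).
by move=> x; rewrite mul1r addrC.
Qed.

Lemma Rintegral_shift (s : R) (f : R -> R) : L1 f ->
  \int[mu]_x f (x + s) = \int[mu]_x f x.
Proof.
move=> fi; rewrite [RHS](@Rintegral_affine R s 1 (oner_neq0 _))// normr1 mul1r.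
by apply: eq_Rintegral => x _; rewrite mul1r addrC.
Qed.

(** A trapezoid of height 1 whose slopes occupy the last unit before -n and n. *)
Let cutoff (n : nat) (x : R) : R := Num.max 0 (Num.min 1 (n%:R - `|x|)).

Let cutoff_ge0 n x : 0 <= cutoff n x.
Proof. by rewrite /cutoff le_max lexx. Qed.

Let cutoff_le1 n x : cutoff n x <= 1.
Proof. by rewrite /cutoff ge_max ler01 ge_min lexx. Qed.

Let cutoff_out n x : n%:R <= `|x| -> cutoff n x = 0.
Proof.
move=> nx; apply/max_idPl; rewrite ge_min; apply/orP; right.
by rewrite subr_le0.
Qed.

Let cutoff_in n x : `|x| + 1 <= n%:R -> cutoff n x = 1.
Proof.
move=> nx; rewrite /cutoff; have -> : Num.min 1 (n%:R - `|x|) = 1.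
  by apply/min_idPl; rewrite lerBrDr addrC.
by apply/max_idPr.
Qed.

Let continuous_cutoff n : continuous (cutoff n).
Proof.
move=> x; apply: (@continuous_max _ _ (cst 0) (fun x => Num.min 1 (n%:R - `|x|))).
  exact: cvg_cst.
apply: (@continuous_min _ _ (cst 1) (fun x => n%:R - `|x|)); first exact: cvg_cst.
apply: cvgB; first exact: cvg_cst.
exact: norm_continuous.
Qed.

Let measurable_cutoff n : measurable_fun setT (cutoff n).
Proof. exact: continuous_measurable_fun. Qed.

(** Half of [eps] pays for cutting [p] off, by dominated convergence; the other half for a
    continuous approximation [g] on the segment [E]. Multiplying [g] by the same cutoff makes it
    continuous on the line and compactly supported, and hides its values outside [E], where nothing
    is known about it. *)
Lemma continuous_compact_support_dense (p : R -> R) (eps : R) : L1 p -> 0 < eps ->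
  exists (k : R -> R) (M C : R), [/\ continuous k,
    forall x, M <= `|x| -> k x = 0, forall x, `|k x| <= C, L1 k &
    \int[mu]_x `|p x - k x| <= eps].
Proof.
move=> pi eps0; have mp := L1_measurable pi; have mcut := measurable_cutoff.
have [n Hn] : exists n, \int[mu]_x `|p x - p x * cutoff n x| <= eps / 2.
  have [] := @dominated_convergence _ _ R mu setT measurableT
    (fun n x => (p x * cutoff n x)%:E) (EFin \o p) (fun x => `|p x|%:E).
  - by move=> n; apply/measurable_EFinP; mfun; exact: mcut.
  - exact/measurable_EFinP.
  - apply: aeW => x _; apply: cvg_EFin.
      by near=> n.
    apply: (@cvg_near_cst _ _ _ (fun n => p x * cutoff n x)).
    near=> n; rewrite /= cutoff_in ?mulr1//.
    by near: n; exact: nbhs_infty_ger.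
  - exact: L1_norm.
  - apply: aeW => x n _; rewrite lee_fin normrM.
    rewrite (ger0_norm (cutoff_ge0 _ _)) ler_piMr//.
  move=> _ /fine_cvgP[_ /cvgrPdist_le/(_ (eps / 2))]; rewrite divr_gt0// => /(_ isT).
  move=> [n _ /(_ n (leqnn n))/=]; rewrite sub0r normrN => H _; exists n.
  apply: le_trans H; apply: le_trans (ler_norm _).
  rewrite /Rintegral le_eqVlt; apply/orP; left; apply/eqP; congr fine.
  by apply: eq_integral => x _; rewrite /= distrC.
pose E : set (measurableTypeR R) := `[- n%:R, n%:R]%classic.
have mE : measurable E by exact: measurable_itv.
have [g [cg ig Hg]] : exists g : R -> R, [/\ continuous g, 
    mu.-integrable E (EFin \o g) &
    \int[mu]_(x in E) `|p x - g x| <= eps / 2].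
  have [||g_ [c_ i_]] := @approximation_continuous_integrable R E p mE.
  - have : (mu E < +oo)%E; last by [].
    by rewrite /E lebesgue_measure_itv/=; case: ifP => // _; rewrite -EFinB ltry.
  - exact: integrableS pi.
  move=> /fine_cvgP[_ /cvgrPdist_le/(_ (eps / 2))]; rewrite divr_gt0// => /(_ isT).
  move=> [N _ /(_ N (leqnn N))/=]; rewrite sub0r normrN => H; exists (g_ N).
  by split => //; exact: le_trans (ler_norm _) H.
have [C HC] : exists C, forall x, `|g x * cutoff n x| <= C.
  have /compact_bounded[M [_ HM]] : compact (g @` E).
    apply: continuous_compact; last exact: segment_compact.
    exact: continuous_subspaceT.
  exists (Num.max 0 (M + 1)) => x.
  have [xn|xn] := leP n%:R `|x|.
    by rewrite cutoff_out// mulr0 normr0 le_max lexx.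
  rewrite normrM (ger0_norm (cutoff_ge0 _ _)).
  rewrite (@le_trans _ _ `|g x|)// ?ler_piMr//.
  rewrite le_max; apply/orP; right; apply: HM; first by rewrite ltrDl.
  by exists x => //; rewrite /E /= in_itv/= -ler_norml ltW.
have ck : continuous (fun x => g x * cutoff n x).
  by move=> x; apply: cvgM; [exact: cg|exact: continuous_cutoff].
have mg : measurable_fun setT g by exact: continuous_measurable_fun.
have mk : measurable_fun setT (fun x => g x * cutoff n x) by mfun; exact: mcut.
have ki : L1 (fun x => g x * cutoff n x).
  have gi : L1 (fun x => `|g x| * \1_E x).
    by apply: L1_indic => //; exact: integrable_norm.
  apply: L1_le gi _ => //= x; rewrite normrM ler_wpM2l//.
  rewrite ger0_norm// indicE; case: (boolP (x \in E)) => //= /negP xE.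
  rewrite cutoff_out// leNgt; apply/negP => xn; apply: xE; rewrite inE /E /= in_itv/=.
  by rewrite -ler_norml ltW.
exists (fun x => g x * cutoff n x), n%:R, C; split => //.
  by move=> x nx; rewrite cutoff_out// mulr0.
rewrite (splitr eps).
have cutoff_bnd x : `|cutoff n x| <= 1 by rewrite ger0_norm.
have cutoff_indic x : `|cutoff n x| <= \1_E x.
  rewrite ger0_norm// indicE; case: (boolP (x \in E)) => //= /negP xE.
  rewrite cutoff_out// leNgt; apply/negP => xn; apply: xE; rewrite inE /E /= in_itv/=.
  by rewrite -ler_norml ltW.
have iE : L1 (fun x => `|p x - g x| * \1_E x).
  have hE : mu.-integrable E (EFin \o (fun x => `|p x - g x|)).
    have ppi : mu.-integrable E (EFin \o p) by exact: integrableS pi.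
    have : mu.-integrable E (EFin \o (fun x => p x - g x)).
      by move: (integrableB mE ppi ig); apply: eq_integrable.
    exact: integrable_norm.
  exact: L1_indic.
apply: (@le_trans _ _ (\int[mu]_x (`|p x - p x * cutoff n x| + `|p x - g x| * \1_E x))).
  apply: le_Rintegral => //.
  - apply: L1_norm; exact: L1B.
  - apply: L1D; last exact: iE.
    by apply: L1_norm; apply: L1B => //; apply: (L1_bounded_mul pi (mcut n) cutoff_bnd).
  - move=> x _; have -> : p x - g x * cutoff n x =
        (p x - p x * cutoff n x) + (p x - g x) * cutoff n x by ring.
    rewrite (le_trans (ler_normD _ _))// lerD2l normrM ler_wpM2l//.
rewrite RintegralD//; last first.
  by apply: L1_norm; apply: L1B => //; apply: (L1_bounded_mul pi (mcut n) cutoff_bnd).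
rewrite lerD// (le_trans _ Hg)// le_eqVlt; apply/orP; left; apply/eqP.
rewrite [RHS]Rintegral_mkcond; apply: eq_Rintegral => x _.
by rewrite /patch indicE; case: ifPn => _; rewrite ?mulr1 ?mulr0.
Unshelve. all: by end_near. Qed.

(** An eps/3 argument: translation preserves the L1 distance from [p] to a continuous compactly
    supported [k], and for [k] itself dominated convergence applies. *)
Lemma L1_translation_cvg (p : R -> R) (e : nat -> R) : L1 p ->
  e @ \oo --> 0 -> (\int[mu]_x `|p (x + e n) - p x|) @[n --> \oo] --> 0.
Proof.
move=> pi e0; apply/cvgrPdist_le => eps eps0.
have e3 : 0 < eps / 3 by rewrite divr_gt0.
have [k [M [C [ck kM kC ki Hk]]]] := continuous_compact_support_dense pi e3.
have mk := L1_measurable ki.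
have mks (s : R) : measurable_fun setT (fun x : R => k (x + s)).
  exact: L1_measurable (L1_shift _ ki).
have kcvg : (\int[mu]_x `|k (x + e n) - k x|) @[n --> \oo] --> 0.
  (* Past the index [N] all translations are by at most 1, so the differences vanish outside [E] as
     soon as [N0] exceeds |M| + 1. This gives the dominating function [(C + C) * \1_E]. *)
  have [N _ HN] : \forall n \near \oo, `|e n| <= 1.
    by move/cvgrPdist_le : e0 => /(_ 1 ltr01); apply: filterS => n; rewrite sub0r normrN.
  have [N0 M1] : exists N0 : nat, `|M| + 1 <= N0%:R.
    by exists (Num.bound (`|M| + 1)); rewrite ltW// archi_boundP// addr_ge0.
  pose E : set (measurableTypeR R) := `[- N0%:R, N0%:R]%classic.
  have mE : measurable E by exact: measurable_itv.
  have EI : L1 (fun x => (C + C) * \1_E x).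
    by apply: L1Z; apply: eq_L1 (integrable_indic_itv _ _ _ _).
  have [] := @dominated_convergence _ _ R mu setT measurableT
    (fun n x => `|k (x + e (n + N)%N) - k x|%:E) (cst 0%E) (fun x => ((C + C) * \1_E x)%:E).
  - by move=> n; apply/measurable_EFinP; mfun; exact: mks.
  - exact: measurable_cst.
  - apply: aeW => x _; apply: cvg_EFin; first by near=> n.
    rewrite -(normr0 R) -(subrr (k x)); apply: cvg_norm; apply: cvgB; last exact: cvg_cst.
    apply: continuous_cvg; first exact: ck.
    rewrite -[X in _ --> X]addr0; apply: cvgD; first exact: cvg_cst.
    by move: e0; rewrite -(cvg_shiftn N).
  - exact: EI.
  - apply: aeW => x n _; rewrite lee_fin normr_id.
    have en1 : `|e (n + N)%N| <= 1 by apply: HN; rewrite /= leq_addl.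
    rewrite indicE; case: (boolP (x \in E)) => /= xE.
      by rewrite mulr1 (le_trans (ler_normB _ _))// lerD.
    have xN0 : N0%:R < `|x|.
      rewrite ltNge; apply: contra xE => xN; rewrite inE /E/= in_itv/=.
      by rewrite -ler_norml.
    have := ler_norm M; have := ler_normB (x + e (n + N)%N) (e (n + N)%N).
    rewrite addrK => h1 h2.
    by rewrite !kM ?subrr ?normr0 ?mulr0//; lra.
  move=> _ _; rewrite integral0 => /fine_cvgP[_ H].
  rewrite -(@cvg_shiftn N).
  by apply: cvg_trans H; apply: near_eq_cvg; near=> n.
have pki : L1 (fun x => `|p x - k x|) by apply: L1_norm; exact: L1B.
move/cvgrPdist_le : kcvg => /(_ _ e3); apply: filterS => n.
rewrite !sub0r !normrN => H.
rewrite ger0_norm; last by apply: Rintegral_ge0.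
have Hsum : \int[mu]_x `|p (x + e n) - p x| <=
    \int[mu]_x (`|p (x + e n) - k (x + e n)| + (`|k (x + e n) - k x| + `|p x - k x|)).
  apply: le_Rintegral => //.
  - by apply: L1_norm; apply: L1B => //; exact: L1_shift.
  - apply: L1D; first exact: (L1_shift _ pki).
    by apply: L1D => //; apply: L1_norm; apply: L1B => //; exact: L1_shift.
  - move=> x _; have -> : p (x + e n) - p x = (p (x + e n) - k (x + e n)) +
      ((k (x + e n) - k x) - (p x - k x)) by ring.
    rewrite (le_trans (ler_normD _ _))// lerD2l.
    exact: ler_normB.
apply: le_trans Hsum _.
have kki : L1 (fun x => `|k (x + e n) - k x|).
  by apply: L1_norm; apply: L1B => //; exact: L1_shift.
rewrite RintegralD//; last 2 first.
  exact: (L1_shift _ pki).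
  exact: L1D.
rewrite RintegralD// (Rintegral_shift (e n) pki).
have {H} := le_trans (ler_norm _) H; move: Hk.
set I1 := Rintegral _ _ _; set I2 := Rintegral _ _ _ => h1 h2.
rewrite (_ : eps = eps / 3 + (eps / 3 + eps / 3)); last by field.
exact: lerD h1 (lerD h2 h1).
Unshelve. all: by end_near. Qed.

End translation.

(** * Continuity of the autocorrelation at the origin *)

Section autocorrelation.
Context {R : realType}.
Notation mu := (@lebesgue_measure R).
Notation L1 := (L1 mu).

(** L1 continuity of translations controls the increment of [p] only against a bounded factor, and
    [p] may be unbounded. It is therefore split into its clipping [q N], bounded by [N], and a
    remainder small in L2, which is paired with the increment by a weighted AM-GM inequality. *)
Lemma autocorrelation_cvg (p : R -> R) (e : nat -> R) :
  L1 p -> L1 (fun x => p x ^+ 2) -> e @ \oo --> 0 ->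
  (\int[mu]_x (p x * p (x + e n))) @[n --> \oo] --> \int[mu]_x (p x ^+ 2).
Proof.
move=> pi p2 e0; have mp := L1_measurable pi.
apply/cvgrPdist_le => eps eps0.
pose P := \int[mu]_x (p x ^+ 2).
have P0 : 0 <= P by apply: Rintegral_ge0 => x _; exact: sqr_ge0.
(* Chosen so that [lam^-1 * (P + P)], the price of the AM-GM inequality in the squared increment,
   stays below eps/3. The weight [lam / 2] on the remainder then dictates the precision
   [2 / lam * (eps / 3)] asked of the clipping level [N]. *)
pose lam := 6 * (P + 1) / eps.
have lam0 : 0 < lam by rewrite divr_gt0// mulr_gt0// ltr_wpDl.
pose q (N : nat) x := Num.min N%:R (Num.max (- N%:R) (p x)).
have mq N : measurable_fun setT (q N).
  by apply: measurable_minr => //; exact: measurable_maxr.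
have qN (N : nat) x : `|q N x| <= N%:R.
  rewrite ler_norml /q le_min ge_min le_max !lexx /= !andbT.
  by rewrite (le_trans _ (ler0n _ _))// oppr_le0.
have qp (N : nat) x : `|p x| <= N%:R -> q N x = p x.
  rewrite ler_norml => /andP[h1 h2]; rewrite /q.
  by rewrite (max_idPr h1) (min_idPr h2).
have pq (N : nat) x : (p x - q N x) ^+ 2 <= p x ^+ 2.
  rewrite -[leLHS]real_normK ?num_real// -[leRHS]real_normK ?num_real//.
  rewrite ler_pXn2r ?nnegrE//.
  have N0 : (0 : R) <= N%:R by [].
  have [h|h] := leP `|p x| N%:R; first by rewrite qp// subrr normr0.
  rewrite /q; move: h; rewrite lter_normr => /orP[h|h].
    rewrite max_r; last by rewrite (le_trans _ (ltW h))// (le_trans _ N0)// oppr_le0.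
    rewrite min_l; last exact: ltW.
    by rewrite !ger0_norm; lra.
  rewrite max_l; last by rewrite lerNr ltW.
  rewrite min_r; last by rewrite (le_trans _ N0)// oppr_le0.
  by rewrite !ler0_norm; lra.
have pq2 N : L1 (fun x => (p x - q N x) ^+ 2).
  apply: (L1_le _ p2); first by mfun; exact: mq.
  by move=> x; rewrite ger0_norm ?sqr_ge0// pq.
have [N HN] : exists N, \int[mu]_x ((p x - q N x) ^+ 2) <= 2 / lam * (eps / 3).
  have [] := @dominated_convergence _ _ R mu setT measurableT
    (fun n x => ((p x - q n x) ^+ 2)%:E) (cst 0%E) (fun x => (p x ^+ 2)%:E).
  - by move=> n; apply/measurable_EFinP; mfun; exact: mq.
  - exact: measurable_cst.
  - apply: aeW => x _; apply: cvg_EFin; first by near=> n.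
    apply: (@cvg_near_cst _ _ _ (fun n => (p x - q n x) ^+ 2)).
    near=> n; rewrite /= qp ?subrr ?expr0n//=.
    by near: n; exact: nbhs_infty_ger.
  - exact: p2.
  - by apply: aeW => x n _; rewrite lee_fin ger0_norm ?sqr_ge0.
  move=> _ _; rewrite integral0 => /fine_cvgP[_ /cvgrPdist_le H].
  have : 0 < 2 / lam * (eps / 3) by apply: mulr_gt0; apply: divr_gt0.
  move=> /H[n _ /(_ n (leqnn n))/=]; rewrite sub0r normrN => Hn; exists n.
  exact: le_trans (ler_norm _) Hn.
have tcvg := L1_translation_cvg pi e0.
have N1 : 0 < eps / 3 / (N%:R + 1) by rewrite divr_gt0// ?divr_gt0// ltr_wpDl.
move/cvgrPdist_le : tcvg => /(_ _ N1); apply: filterS => n.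
rewrite sub0r normrN => /(le_trans (ler_norm _)) Hn.
have mps : measurable_fun setT (fun x : R => p (x + e n)).
  exact: L1_measurable (L1_shift _ pi).
have p2s : L1 (fun x : R => p (x + e n) ^+ 2) by exact: (L1_shift _ p2).
have pps : L1 (fun x => p x * p (x + e n)) by exact: L1_mul.
have dsi : L1 (fun x => `|p (x + e n) - p x|).
  by apply: L1_norm; apply: L1B => //; exact: L1_shift.
rewrite -RintegralB//.
apply: (@le_trans _ _ (\int[mu]_x `|p x ^+ 2 - p x * p (x + e n)|)).
  by apply: le_normr_Rintegral => //; exact: L1B.
have I1 : L1 (fun x => lam / 2 * (p x - q N x) ^+ 2) by exact: L1Z.
have I2 : L1 (fun x => lam^-1 * (p (x + e n) ^+ 2 + p x ^+ 2)).
  by apply: L1Z; exact: L1D.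
have I3 : L1 (fun x => N%:R * `|p (x + e n) - p x|) by exact: L1Z.
apply: (@le_trans _ _ (\int[mu]_x (lam / 2 * (p x - q N x) ^+ 2 +
    (lam^-1 * (p (x + e n) ^+ 2 + p x ^+ 2) + N%:R * `|p (x + e n) - p x|)))).
  apply: le_Rintegral => //.
  - by apply: L1_norm; exact: L1B.
  - by apply: L1D => //; exact: L1D.
  - move=> x _; set a := p (x + e n); set b := p x; set c := q N x.
    have -> : b ^+ 2 - b * a = - ((b - c) * (a - b) + c * (a - b)) by ring.
    rewrite normrN (le_trans (ler_normD _ _))// addrA lerD//; last first.
      by rewrite normrM ler_wpM2r//; exact: qN.
    have h1 : lam^-1 * (a - b) ^+ 2 <= lam^-1 * (2 * (a ^+ 2 + b ^+ 2)).
      rewrite ler_pM2l ?invr_gt0//.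
      by have := sqr_ge0 (a + b); rewrite !expr2; lra.
    (* The squares with the two signs bound (b - c)(a - b) from below and from above. *)
    have h2 : 0 <= lam / 2 * (b - c + lam^-1 * (a - b)) ^+ 2.
      by rewrite mulr_ge0 ?sqr_ge0// ltW// divr_gt0.
    have h3 : 0 <= lam / 2 * (b - c - lam^-1 * (a - b)) ^+ 2.
      by rewrite mulr_ge0 ?sqr_ge0// ltW// divr_gt0.
    have e1 : lam / 2 * (b - c + lam^-1 * (a - b)) ^+ 2 =
       lam / 2 * (b - c) ^+ 2 + (b - c) * (a - b) + lam^-1 * (a - b) ^+ 2 / 2.
      by field; rewrite gt_eqF.
    have e2 : lam / 2 * (b - c - lam^-1 * (a - b)) ^+ 2 =
       lam / 2 * (b - c) ^+ 2 - (b - c) * (a - b) + lam^-1 * (a - b) ^+ 2 / 2.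
      by field; rewrite gt_eqF.
    rewrite e1 in h2; rewrite e2 in h3; rewrite ler_norml; apply/andP; split; lra.
rewrite RintegralD//; last exact: L1D.
have I0 := pq2 N; have I2' := L1D p2s p2.
rewrite RintegralD// !RintegralZl//.
rewrite RintegralD// (Rintegral_shift (e n) p2) -/P.
have lamV : lam^-1 * (P + P) <= eps / 3.
  rewrite ler_pdivrMl// /lam.
  have -> : 6 * (P + 1) / eps * (eps / 3) = 2 * (P + 1) by field; rewrite gt_eqF.
  by lra.
have D1 : lam / 2 * \int[mu]_x ((p x - q N x) ^+ 2) <= eps / 3.
  have l2 : 0 <= lam / 2 by rewrite ltW// divr_gt0.
  apply: le_trans (ler_wpM2l l2 HN) _; rewrite le_eqVlt; apply/orP; left.
  by apply/eqP; field; rewrite gt_eqF.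
have D3 : N%:R * \int[mu]_x `|p (x + e n) - p x| <= eps / 3.
  have N0 : (0 : R) <= N%:R by [].
  rewrite (@le_trans _ _ ((N%:R + 1) * \int[mu]_x `|p (x + e n) - p x|))//.
    by rewrite ler_wpM2r ?lerDl//; apply: Rintegral_ge0.
  by rewrite [leLHS]mulrC -ler_pdivlMr ?ltr_wpDl.
rewrite (_ : eps = eps / 3 + (eps / 3 + eps / 3)); last by field.
exact: lerD D1 (lerD lamV D3).
Unshelve. all: by end_near. Qed.

End autocorrelation.

(** * The Poisson kernel *)

Section poisson.
Context {R : realType}.
Notation mu := (@lebesgue_measure R).
Notation L1 := (L1 mu).

Let onex (x : R) : 0 < 1 + x ^+ 2.
Proof. by rewrite ltr_pwDl// sqr_ge0. Qed.

(** The summand 1 makes the integrand nonnegative, so that the fundamental theorem of calculus on a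
    half-line applies to an explicit primitive. Its contribution is subtracted later. *)
Lemma integral0y_expR_cos (x : R) :
  (\int[mu]_(t in `[0%R, +oo[) (expR (- t) * (1 + cos (x * t)))%:E =
   (1 + (1 + x ^+ 2)^-1)%:E)%E.
Proof.
pose F (t : R) := - expR (- t) +
  (1 + x ^+ 2)^-1 * (expR (- t) * (x * sin (x * t) - cos (x * t))).
have dF (t : R) : is_derive t 1 F (expR (- t) * (1 + cos (x * t))).
  have d1 : is_derive t 1 (fun t => expR (- t)) (- expR (- t)).
    by apply: is_derive_eq; rewrite mulrN1.
  have d2 : is_derive t 1 (fun t => sin (x * t)) (x * cos (x * t)).
    by apply: is_derive_eq; rewrite /GRing.scale /= mulr1 mulrC.
  have d3 : is_derive t 1 (fun t => cos (x * t)) (- (x * sin (x * t))).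
    by apply: is_derive_eq; rewrite /GRing.scale /= mulr1 mulNr mulrC.
  apply: is_derive_eq; rewrite /GRing.scale /=.
  by field; rewrite gt_eqF.
have cF : continuous F.
  by move=> t; apply: differentiable_continuous; apply/derivable1_diffP; apply: ex_derive.
have cf : continuous (fun t : R => expR (- t) * (1 + cos (x * t))).
  move=> t; apply: cvgM.
    apply: (@continuous_comp _ _ _ (fun t : R => - t) expR); last exact: continuous_expR.
    by apply: cvgN; exact: cvg_id.
  apply: cvgD; first exact: cvg_cst.
  apply: (@continuous_comp _ _ _ ( *%R x) cos); last exact: continuous_cos.
  exact: mulrl_continuous.
rewrite (@ge0_continuous_FTC2y _ _ F 0 0).
- rewrite -EFinB /F oppr0 expR0 !mulr0 sin0 cos0.
  by congr EFin; ring.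
- move=> t _; apply: mulr_ge0; first exact: expR_ge0.
  by have := cos_geN1 (x * t); lra.
- exact: continuous_subspaceT.
(* The primitive is bounded by [K * expR (- t)], hence vanishes at infinity. *)
- pose K : R := 1 + (1 + x ^+ 2)^-1 * (`|x| + 1).
  have e0 : (K * expR (- t)) @[t --> +oo] --> 0.
    by rewrite -(mulr0 K); apply: cvgMr; exact: cvgr_expR.
  have e0N : (- (K * expR (- t))) @[t --> +oo] --> 0.
    by rewrite -(oppr0 R); exact: cvgN.
  apply: squeeze_cvgr e0N e0; near=> t.
  rewrite -ler_norml /F (le_trans (ler_normD _ _))// normrN.
  rewrite (ger0_norm (expR_ge0 _)) /K mulrDl mul1r lerD2l normrM.
  rewrite (ger0_norm (ltW _)) ?invr_gt0// -mulrA ler_pM2l ?invr_gt0//.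
  rewrite normrM (ger0_norm (expR_ge0 _)) mulrC ler_wpM2r ?expR_ge0//.
  rewrite (le_trans (ler_normB _ _))// lerD ?cos_max// normrM.
  by rewrite ler_piMr// sin_max.
- by move=> t _; apply: ex_derive.
- by apply: cvg_at_right_filter; exact: cF.
- by move=> t _; rewrite derive1E; exact: derive_val.
Unshelve. all: by end_near. Qed.

Let ker (x t : R) := expR (- `|t|) * (1 + cos (x * t)).

Let ker_ge0 x t : 0 <= ker x t.
Proof.
apply: mulr_ge0; first exact: expR_ge0.
by have := cos_geN1 (x * t); lra.
Qed.

Let continuous_ker x : continuous (ker x).
Proof.
move=> t; apply: cvgM.
  apply: (@continuous_comp _ _ _ (fun t : R => - `|t|) expR); last exact: continuous_expR.
  by apply: cvgN; exact: norm_continuous.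
apply: cvgD; first exact: cvg_cst.
apply: (@continuous_comp _ _ _ ( *%R x) cos); last exact: continuous_cos.
exact: mulrl_continuous.
Qed.

Let integral_ker x : (\int[mu]_t (ker x t)%:E = (2 * (1 + (1 + x ^+ 2)^-1))%:E)%E.
Proof.
have kerN : ker x =1 ker x \o -%R by move=> t; rewrite /ker /= normrN mulrN cosN.
rewrite (ge0_symfun_integralT (@ker_ge0 x) (@continuous_ker x) kerN).
rewrite EFinM -integral0y_expR_cos -set_itvcy; congr (_ * _)%E.
apply: eq_integral => t; rewrite inE/= in_itv/= andbT => t0.
by rewrite /ker ger0_norm.
Qed.

Let L1_ker x : L1 (ker x).
Proof.
apply: L1_ge0 => //; first exact: continuous_measurable_fun.
by rewrite integral_ker ltry.
Qed.

(** At frequency 0 the kernel is twice the plain exponential, so half of it is exactly the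
    nonnegative correction to remove. *)
Let kerE x t : expR (- `|t|) * cos (x * t) = ker x t - 2^-1 * ker 0 t.
Proof. by rewrite /ker mul0r cos0; field. Qed.

Lemma L1_expR_norm_cos (x : R) : L1 (fun t => expR (- `|t|) * cos (x * t)).
Proof.
under eq_fun do rewrite kerE.
by apply: L1B => //; exact: L1Z.
Qed.

Lemma L1_expR_norm : L1 (fun t : R => expR (- `|t|)).
Proof.
by apply: eq_L1 (L1_expR_norm_cos 0) => t; rewrite mul0r cos0 mulr1.
Qed.

Lemma Rintegral_expR_norm_cos (x : R) :
  \int[mu]_t (expR (- `|t|) * cos (x * t)) = 2 / (1 + x ^+ 2).
Proof.
under eq_Rintegral do rewrite kerE.
have Kx := L1_ker x; have K0 := L1_ker 0; have K0' := L1Z 2^-1 K0.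
rewrite RintegralB//.
have H y : \int[mu]_t ker y t = 2 * (1 + (1 + y ^+ 2)^-1).
  by rewrite /Rintegral integral_ker.
rewrite RintegralZl// !H expr0n addr0.
by field; rewrite gt_eqF.
Qed.

Lemma Rintegral_expR_norm_cos_scale (x e : R) : 0 < e ->
  \int[mu]_t (expR (- `|e * t|) * cos (x * t)) = e^-1 * (2 / (1 + (x / e) ^+ 2)).
Proof.
move=> e0; rewrite -Rintegral_expR_norm_cos.
have e1 : e != 0 by rewrite gt_eqF.
rewrite [in RHS](Rintegral_affine 0 e1 (L1_expR_norm_cos (x / e))).
rewrite gtr0_norm// mulKf//; apply: eq_Rintegral => t _.
by rewrite add0r mulrA divfK.
Qed.

(** This total mass is the source of the factor [2 * pi] in Plancherel's identity. *)
Lemma integral_poisson :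
  (\int[mu]_s (2 / (1 + s ^+ 2))%:E = (2 * pi)%:E)%E.
Proof.
pose P (s : R) := 2 / (1 + s ^+ 2).
have P0 s : 0 <= P s by rewrite divr_ge0// ltW.
have PN : P =1 P \o -%R by move=> s; rewrite /P /= sqrrN.
have cP : continuous P.
  move=> s; apply: cvgM; first exact: cvg_cst.
  exact: continuous_oneDsqrV.
rewrite (ge0_symfun_integralT P0 cP PN) /P.
rewrite -set_itvcy EFinM; congr (_ * _)%E.
under eq_integral do rewrite EFinM.
rewrite ge0_integralZl//.
- by rewrite integral0y_oneDsqr -EFinM; congr EFin; field.
- apply/measurable_EFinP/measurable_funTS; apply: continuous_measurable_fun.
  exact: continuous_oneDsqrV.
- by move=> s _; rewrite lee_fin invr_ge0 ltW.
Qed.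

Lemma measurable_poisson : measurable_fun setT (fun s : R => 2 / (1 + s ^+ 2)).
Proof.
apply: measurable_funM; first exact: measurable_cst.
by apply: continuous_measurable_fun; exact: continuous_oneDsqrV.
Qed.

Lemma L1_poisson : L1 (fun s : R => 2 / (1 + s ^+ 2)).
Proof.
apply: L1_ge0; first exact: measurable_poisson.
  by move=> s; rewrite divr_ge0// ltW.
by rewrite integral_poisson ltry.
Qed.

End poisson.

(** * Fubini for real-valued integrals *)

Section Rfubini.
Context {R : realType}.
Notation mu := (@lebesgue_measure R).
Notation L1 := (L1 mu).

(** Bounding the L1 norms of the slices by an integrable [v] gives integrability on the product,
    through Tonelli applied to |F|. *)
Lemma Rfubini (F : R * R -> R) (v : R -> R) : measurable_fun setT F ->
  (forall x, L1 (fun y => F (x, y))) -> (forall y, L1 (fun x => F (x, y))) ->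
  L1 v -> (forall y, \int[mu]_x `|F (x, y)| <= v y) ->
  \int[mu]_x \int[mu]_y F (x, y) = \int[mu]_y \int[mu]_x F (x, y).
Proof.
move=> mF F1 F2 vi Fv.
have iF : (mu \x mu)%E.-integrable setT (EFin \o F).
  apply/integrable21ltyP; first exact/measurable_EFinP.
  apply: (@le_lt_trans _ _ (\int[mu]_y (v y)%:E)%E); last first.
    by rewrite (L1_fineK vi) ltry.
  apply: ge0_le_integral => //.
  - by move=> y _; exact: integral_ge0.
  - apply: (@measurable_fun_fubini_tonelli_G _ _ (measurableTypeR R)
      (measurableTypeR R) R mu (abse \o (EFin \o F))) => //=.
    by apply: measurableT_comp => //; exact/measurable_EFinP.
  - by apply/measurable_EFinP; exact: L1_measurable vi.
  - by move=> y _; rewrite (L1_fineK (L1_norm (F2 y))) lee_fin.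
have := Fubini iF.
under eq_integral do rewrite (L1_fineK (F1 _)).
under [RHS]eq_integral do rewrite (L1_fineK (F2 _)).
by rewrite /Rintegral => ->.
Qed.

Lemma Rfubini_tensor (F : R * R -> R) (u v : R -> R) : measurable_fun setT F ->
  L1 u -> L1 v -> (forall x y, `|F (x, y)| <= u x * v y) ->
  \int[mu]_x \int[mu]_y F (x, y) = \int[mu]_y \int[mu]_x F (x, y).
Proof.
move=> mF ui vi Fuv.
have F1 x : L1 (fun y => F (x, y)).
  by apply: (L1_le _ (L1Z (u x) vi)) => //; exact: measurableT_comp.
have F2 y : L1 (fun x => F (x, y)).
  apply: (L1_le _ (L1Z (v y) ui)); first exact: measurableT_comp.
  by move=> x; rewrite mulrC.
apply: (@Rfubini _ (fun y => (\int[mu]_x u x) * v y)) => //; first exact: L1Z.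
move=> y; rewrite -RintegralZr//; apply: le_Rintegral => //.
  exact: L1_norm.
by apply: eq_L1 (L1Z (v y) ui) => x; rewrite mulrC.
Qed.

End Rfubini.

(** * Plancherel's identity for real functions *)

Section plancherel_real.
Context {R : realType}.
Notation mu := (@lebesgue_measure R).
Notation L1 := (L1 mu).

Definition cos_transform (p : R -> R) (t : R) := \int[mu]_x (p x * cos (x * t)).
Definition sin_transform (p : R -> R) (t : R) := \int[mu]_x (p x * sin (x * t)).

Lemma L1_cos (p : R -> R) (t : R) : L1 p -> L1 (fun x => p x * cos (x * t)).
Proof.
move=> pi; apply: (@L1_bounded_mul _ _ _ _ 1) => //; first by mfun.
by move=> x; exact: cos_max.
Qed.

Lemma L1_sin (p : R -> R) (t : R) : L1 p -> L1 (fun x => p x * sin (x * t)).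
Proof.
move=> pi; apply: (@L1_bounded_mul _ _ _ _ 1) => //; first by mfun.
by move=> x; exact: sin_max.
Qed.

Lemma measurable_cos_transform (p : R -> R) : measurable_fun setT p ->
  measurable_fun setT (cos_transform p).
Proof.
move=> mp; apply: (@measurable_fun_Rintegral _ _ _ _ _ mu
  (fun z : R * R => p z.2 * cos (z.2 * z.1))).
by mfun; exact: (measurableT_comp mp).
Qed.

Lemma measurable_sin_transform (p : R -> R) : measurable_fun setT p ->
  measurable_fun setT (sin_transform p).
Proof.
move=> mp; apply: (@measurable_fun_Rintegral _ _ _ _ _ mu
  (fun z : R * R => p z.2 * sin (z.2 * z.1))).
by mfun; exact: (measurableT_comp mp).
Qed.

Lemma cos_transform_le (p : R -> R) (t : R) : L1 p ->
  `|cos_transform p t| <= \int[mu]_x `|p x|.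
Proof.
move=> pi; apply: le_trans (le_normr_Rintegral _ _) _ => //; first exact: L1_cos.
apply: le_Rintegral => //; [by apply: L1_norm; exact: L1_cos|exact: L1_norm|].
by move=> x _; rewrite normrM ler_piMr// cos_max.
Qed.

Lemma sin_transform_le (p : R -> R) (t : R) : L1 p ->
  `|sin_transform p t| <= \int[mu]_x `|p x|.
Proof.
move=> pi; apply: le_trans (le_normr_Rintegral _ _) _ => //; first exact: L1_sin.
apply: le_Rintegral => //; [by apply: L1_norm; exact: L1_sin|exact: L1_norm|].
by move=> x _; rewrite normrM ler_piMr// sin_max.
Qed.

Variable p : R -> R.
Hypothesis pi : L1 p.
Hypothesis p2 : L1 (fun x => p x ^+ 2).

Let C := cos_transform p.
Let S := sin_transform p.
Let mp : measurable_fun setT p. Proof. exact: L1_measurable pi. Qed.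
Let mC : measurable_fun setT C. Proof. exact: measurable_cos_transform. Qed.
Let mS : measurable_fun setT S. Proof. exact: measurable_sin_transform. Qed.
Let K := \int[mu]_x `|p x|.
Let K0 : 0 <= K. Proof. exact: Rintegral_ge0. Qed.
Let P (s : R) := 2 / (1 + s ^+ 2).

Let P_ge0 s : 0 <= P s.
Proof. by rewrite /P divr_ge0// addr_ge0// sqr_ge0. Qed.

Let P_le2 s : P s <= 2.
Proof.
rewrite /P ler_pdivrMr ?ltr_pwDl ?sqr_ge0//.
by have := sqr_ge0 s; lra.
Qed.

Section weighted.
Variable e : R.
Hypothesis e0 : 0 < e.
Let w (t : R) := expR (- `|e * t|).

Let wi : L1 w.
Proof.
have e1 : e != 0 by rewrite gt_eqF.
apply: eq_L1 (integrable_affine 0 e1 L1_expR_norm) => t.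
by rewrite /w /= add0r.
Qed.

Let w_ge0 t : 0 <= w t. Proof. exact: expR_ge0. Qed.
Let mw : measurable_fun setT w. Proof. exact: L1_measurable wi. Qed.

(** The left side inverts the Fourier transform of [p] at [x] with the damping [w]. Exchanging the
    integrals turns it into a convolution of [p] with the Poisson kernel of width [e]; the
    substitution y = x + e s moves the width from the kernel to the argument of [p], leaving a
    kernel free of [e] as the limit requires. *)
Let inner (x : R) :
  \int[mu]_t (w t * (cos (x * t) * C t + sin (x * t) * S t)) =
  \int[mu]_s (p (x + e * s) * P s).
Proof.
transitivity (\int[mu]_t \int[mu]_y (w t * p y * cos ((x - y) * t))).
  apply: eq_Rintegral => t _.
  rewrite mulrDr !mulrA /C /S /cos_transform /sin_transform -!RintegralZl//;
    [|exact: L1_sin|exact: L1_cos].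
  rewrite -RintegralD//; [|by apply: L1Z; exact: L1_cos|by apply: L1Z; exact: L1_sin].
  by apply: eq_Rintegral => y _; rewrite mulrBl cosB; ring.
rewrite (@Rfubini_tensor _ (fun z => w z.1 * p z.2 * cos ((x - z.2) * z.1))
  w (fun y => `|p y|)) //=.
- transitivity (\int[mu]_y (p y * (e^-1 * P ((x - y) / e)))).
    apply: eq_Rintegral => y _.
    rewrite /P -Rintegral_expR_norm_cos_scale// -RintegralZl//.
      by apply: eq_Rintegral => t _; rewrite /w; ring.
    apply: (L1_le _ wi).
      by mfun.
    move=> t; rewrite normrM (ger0_norm (w_ge0 t)).
    by rewrite ler_piMr// cos_max.
  have e1 : e != 0 by rewrite gt_eqF.
  rewrite (Rintegral_affine x e1); last first.
    apply: (@L1_bounded_mul _ _ _ _ (e^-1 * 2)) => //.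
      apply: measurable_funM => //.
      apply: (measurableT_comp measurable_poisson); by mfun.
    move=> y; rewrite normrM gtr0_norm ?invr_gt0// ler_pM2l ?invr_gt0//.
    by rewrite ger0_norm.
  rewrite gtr0_norm// -RintegralZl//.
    apply: eq_Rintegral => s _.
    rewrite (_ : (x - (x + e * s)) / e = - s); last by field.
    by rewrite /P sqrrN; field; rewrite e1 gt_eqF// ltr_pwDl// sqr_ge0.
  apply: (@L1_bounded_mul _ _ _ _ (e^-1 * 2)).
  - exact: (integrable_affine x e1 pi).
  - apply: measurable_funM => //.
    by apply: (measurableT_comp measurable_poisson); mfun.
  - move=> s; rewrite normrM gtr0_norm ?invr_gt0// ler_pM2l ?invr_gt0//.
    by rewrite ger0_norm.
- by mfun; exact: measurableT_comp.
- exact: L1_norm.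
- move=> t y; rewrite !normrM (ger0_norm (w_ge0 t)) ler_piMr ?cos_max//.
  by rewrite mulr_ge0.
Qed.

(** Writing C^2 + S^2 as the integral of [p x] against cos(x t) C + sin(x t) S and exchanging
    integrals reduces the left side to [inner] tested against [p]. A second exchange produces the
    autocorrelation. *)
Lemma weighted_plancherel :
  \int[mu]_t (w t * (C t ^+ 2 + S t ^+ 2)) =
  \int[mu]_s (P s * \int[mu]_x (p x * p (x + e * s))).
Proof.
have e1 : e != 0 by rewrite gt_eqF.
transitivity (\int[mu]_t \int[mu]_x
    (p x * (w t * (cos (x * t) * C t + sin (x * t) * S t)))).
  apply: eq_Rintegral => t _.
  have Ci := L1_cos t pi; have Si := L1_sin t pi.
  transitivity (\int[mu]_x (w t * C t * (p x * cos (x * t)) +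
      w t * S t * (p x * sin (x * t)))).
    rewrite RintegralD//; [|exact: L1Z|exact: L1Z].
    rewrite !RintegralZl// -/(cos_transform p t) -/(sin_transform p t) -/(C t) -/(S t).
    by ring.
  by apply: eq_Rintegral => x _; ring.
rewrite (@Rfubini_tensor _ (fun z => p z.2 * (w z.1 *
    (cos (z.2 * z.1) * C z.1 + sin (z.2 * z.1) * S z.1)))
  (fun t => (K + K) * w t) (fun y => `|p y|)) //=; last 4 first.
- by mfun; exact: measurableT_comp.
- exact: L1Z.
- exact: L1_norm.
- move=> t x; rewrite !normrM (ger0_norm (w_ge0 t)) [leRHS]mulrC ler_wpM2l//.
  rewrite mulrC ler_wpM2r// (le_trans (ler_normD _ _))// lerD// normrM.
    rewrite -(mul1r K) ler_pM ?cos_max//; exact: cos_transform_le.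
  rewrite -(mul1r K) ler_pM ?sin_max//; exact: sin_transform_le.
transitivity (\int[mu]_x \int[mu]_s (p x * (p (x + e * s) * P s))).
  apply: eq_Rintegral => x _.
  have i1 : L1 (fun s => p (x + e * s) * P s).
    apply: (@L1_bounded_mul _ _ _ _ 2) => //.
    - exact: (integrable_affine x e1 pi).
    - exact: measurable_poisson.
    - by move=> s; rewrite ger0_norm.
  have i2 : L1 (fun t => w t * (cos (x * t) * C t + sin (x * t) * S t)).
    apply: (@L1_bounded_mul _ _ _ _ (K + K)) => //; first by mfun.
    move=> t; rewrite (le_trans (ler_normD _ _))// lerD// normrM.
      rewrite -(mul1r K) ler_pM ?cos_max//; exact: cos_transform_le.
    rewrite -(mul1r K) ler_pM ?sin_max//; exact: sin_transform_le.
  by rewrite (RintegralZl _ _ i1)// (RintegralZl _ _ i2)// inner.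
have mpa : measurable_fun setT (fun z : R * R => p (z.1 + e * z.2)).
  by apply: (measurableT_comp mp); mfun.
have ppi s : L1 (fun x => p x * p (x + e * s)).
  by apply: L1_mul => //; [exact: L1_measurable (L1_shift _ pi)|exact: (L1_shift _ p2)].
have pa2 s : L1 (fun x => p (x + e * s) ^+ 2) by exact: (L1_shift _ p2).
have mps s : measurable_fun setT (fun x : R => p (x + e * s)).
  exact: L1_measurable (L1_shift _ pi).
(* The arguments of [p] are coupled, so the bound is taken slice by slice: AM-GM and translation
   invariance bound the slice at [s] by ||p||^2 times [P s]. *)
rewrite (@Rfubini _ (fun z => p z.1 * (p (z.1 + e * z.2) * P z.2))
  (fun s => (\int[mu]_x (p x ^+ 2)) * P s)) //=.
- apply: eq_Rintegral => s _; rewrite -RintegralZl//.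
    by apply: eq_Rintegral => x _; ring.
  exact: ppi.
- apply: measurable_funM; first exact: (measurableT_comp mp).
  by apply: measurable_funM => //; apply: (measurableT_comp measurable_poisson).
- move=> x; apply: L1Z; apply: (@L1_bounded_mul _ _ _ _ 2) => //.
  + exact: (integrable_affine x e1 pi).
  + exact: measurable_poisson.
  + by move=> s; rewrite ger0_norm.
- move=> s; apply: eq_L1 (L1Z (P s) (ppi s)) => x; ring.
- by apply: L1Z; exact: L1_poisson.
- move=> s.
  apply: (@le_trans _ _ (\int[mu]_x (P s / 2 * (p x ^+ 2 + p (x + e * s) ^+ 2)))).
    apply: le_Rintegral => //.
    + apply: L1_norm.
      by apply: eq_L1 (L1Z (P s) (ppi s)) => x; ring.
    + by apply: L1Z; exact: L1D.
    + move=> x _; rewrite mulrA normrM (ger0_norm (P_ge0 s)) mulrC -mulrA ler_wpM2l//.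
      rewrite ler_norml; have := sqr_ge0 (p x - p (x + e * s)).
      have := sqr_ge0 (p x + p (x + e * s)); rewrite !expr2 => h1 h2.
      by apply/andP; split; lra.
  have pa2s := pa2 s; have p2D := L1D p2 pa2s.
  rewrite RintegralZl// RintegralD// (Rintegral_shift (e * s) p2).
  by rewrite le_eqVlt; apply/orP; left; apply/eqP; field.
Qed.

Lemma L1_weighted : L1 (fun t => w t * (C t ^+ 2 + S t ^+ 2)).
Proof.
apply: (@L1_bounded_mul _ _ _ _ (K ^+ 2 + K ^+ 2)) => //; first by mfun.
move=> t; rewrite ger0_norm ?addr_ge0 ?sqr_ge0//.
have h1 : `|C t| <= K by exact: cos_transform_le.
have h2 : `|S t| <= K by exact: sin_transform_le.
by rewrite -(real_normK (num_real (C t))) -(real_normK (num_real (S t))) lerD//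
  ler_pXn2r// nnegrE.
Qed.

End weighted.

(** The widths 1/(n+1) decrease to 0. On the Fourier side the damping increases to 1, so monotone
    convergence applies before finiteness is known; on the other side the Poisson average is
    dominated and tends to its value at lag 0. Uniqueness of the limit yields both the identity and
    the finiteness. *)
Theorem plancherel_real :
  (\int[mu]_t (C t ^+ 2 + S t ^+ 2)%:E = (2 * trigo.pi * \int[mu]_x (p x ^+ 2))%:E)%E.
Proof.
pose en (n : nat) : R := n.+1%:R^-1.
have en0 n : 0 < en n by rewrite invr_gt0.
have enc : en @ \oo --> 0 by exact: cvg_harmonic.
have mG : measurable_fun setT (fun t => C t ^+ 2 + S t ^+ 2) by mfun.
pose W n t := (expR (- `|en n * t|) * (C t ^+ 2 + S t ^+ 2))%:E.
have Wcvg : (\int[mu]_t W n t @[n --> \oo] --> \int[mu]_t (C t ^+ 2 + S t ^+ 2)%:E)%E.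
  rewrite (_ : (fun t => (C t ^+ 2 + S t ^+ 2)%:E) = (fun t => limn (W ^~ t))); last first.
    apply/funext => t; apply/esym/cvg_lim => //; apply: cvg_EFin; first by near=> n.
    rewrite -[X in _ --> X]mul1r; apply: cvgM; last exact: cvg_cst.
    rewrite -(expR0 R) -(oppr0 R) -(normr0 R) -(mul0r t).
    apply: continuous_cvg; first exact: continuous_expR.
    by apply: cvgN; apply: cvg_norm; apply: cvgM => //; exact: cvg_cst.
  apply: cvg_monotone_convergence => //.
  - by move=> n; apply/measurable_EFinP; mfun.
  - by move=> n t _; rewrite lee_fin mulr_ge0 ?expR_ge0// addr_ge0// sqr_ge0.
  - move=> t _ m n mn; rewrite lee_fin ler_wpM2r ?addr_ge0 ?sqr_ge0//.
    rewrite ler_expR lerN2 !normrM ler_wpM2r// !gtr0_norm//.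
    by rewrite lef_pV2 ?posrE// ler_nat.
have WE n : (\int[mu]_t W n t =
    (\int[mu]_s (P s * \int[mu]_x (p x * p (x + en n * s))))%:E)%E.
  by rewrite -weighted_plancherel// -L1_fineK//; exact: L1_weighted.
have pp (y : R) : L1 (fun x => p x * p (x + y)).
  apply: L1_mul => //; first exact: L1_measurable (L1_shift _ pi).
  exact: (L1_shift _ p2).
have ppP (y : R) : `|\int[mu]_x (p x * p (x + y))| <= \int[mu]_x (p x ^+ 2).
  apply: le_trans (le_normr_Rintegral _ _) _ => //; first exact: pp.
  have p2y := L1_shift y p2.
  apply: (@le_trans _ _ (\int[mu]_x (2^-1 * (p x ^+ 2 + p (x + y) ^+ 2)))).
    apply: le_Rintegral => //.
    + by apply: L1_norm; exact: pp.
    + by apply: L1Z; exact: L1D.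
    + move=> x _.
      rewrite ler_norml; have := sqr_ge0 (p x - p (x + y)).
      have := sqr_ge0 (p x + p (x + y)); rewrite !expr2 => h1 h2.
      by apply/andP; split; lra.
  have p2D := L1D p2 p2y.
  rewrite RintegralZl// RintegralD// (Rintegral_shift y p2).
  by rewrite le_eqVlt; apply/orP; left; apply/eqP; field.
have mrho (c : R) : measurable_fun setT (fun s : R => \int[mu]_x (p x * p (x + c * s))).
  apply: (@measurable_fun_Rintegral _ _ _ _ _ mu
    (fun z : R * R => p z.2 * p (z.2 + c * z.1))).
  apply: measurable_funM; first exact: (measurableT_comp mp).
  by apply: (measurableT_comp mp); mfun.
have Pi := @L1_poisson R; have mP := L1_measurable Pi.
have Rcvg : (\int[mu]_s (P s * \int[mu]_x (p x * p (x + en n * s)))%:E @[n --> \oo]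
    --> \int[mu]_s (P s * \int[mu]_x (p x ^+ 2))%:E)%E.
  have [] := @dominated_convergence _ _ R mu setT measurableT
    (fun n s => (P s * \int[mu]_x (p x * p (x + en n * s)))%:E)
    (fun s => (P s * \int[mu]_x (p x ^+ 2))%:E)
    (fun s => (P s * \int[mu]_x (p x ^+ 2))%:E).
  - by move=> n; apply/measurable_EFinP; apply: measurable_funM => //; exact: mrho.
  - by apply/measurable_EFinP; apply: measurable_funM.
  - apply: aeW => s _; apply: cvg_EFin; first by near=> n.
    apply: cvgM; first exact: cvg_cst.
    apply: autocorrelation_cvg => //.
    by rewrite -(mul0r s); apply: cvgM => //; exact: cvg_cst.
  - by apply: eq_L1 (L1Z (\int[mu]_x (p x ^+ 2)) Pi) => s; rewrite mulrC.
  - apply: aeW => s n _; rewrite lee_fin normrM (ger0_norm (P_ge0 s)).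
    by rewrite ler_wpM2l.
  by [].
have RE n : (\int[mu]_t W n t =
    \int[mu]_s (P s * \int[mu]_x (p x * p (x + en n * s)))%:E)%E.
  rewrite WE -L1_fineK//.
  by apply: (@L1_bounded_mul _ _ _ _ (\int[mu]_x (p x ^+ 2))) => //; exact: mrho.
have Wcvg' : (\int[mu]_s (P s * \int[mu]_x (p x * p (x + en n * s)))%:E @[n --> \oo]
    --> \int[mu]_t (C t ^+ 2 + S t ^+ 2)%:E)%E.
  by under eq_cvg do rewrite -RE.
have -> := cvg_unique _ Wcvg' Rcvg.
under eq_integral do rewrite mulrC EFinM.
rewrite ge0_integralZl//.
- by rewrite integral_poisson -EFinM mulrC.
- exact/measurable_EFinP.
- by move=> s _; rewrite lee_fin.
- by rewrite lee_fin; apply: Rintegral_ge0 => x _; exact: sqr_ge0.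
Unshelve. all: by end_near. Qed.

End plancherel_real.

(** * Squared modulus and unimodular factors *)

Section complex_lemmas.
Context {R : realType}.
Implicit Types (z w : R[i]) (x y : R).

Lemma sqmod_ge0 z : 0 <= sqmod z.
Proof. by rewrite /sqmod addr_ge0// sqr_ge0. Qed.

Lemma sqmodM z w : sqmod (z * w) = sqmod z * sqmod w.
Proof. by case: z w => [a b] [c d]; rewrite /sqmod /=; ring. Qed.

Lemma sqmod1 : sqmod (1 : R[i]) = 1.
Proof. by rewrite /sqmod /= expr1n expr0n addr0. Qed.

Lemma sqmod_eq0 z : (sqmod z == 0) = (z == 0).
Proof.
case: z => a b; rewrite /sqmod /= paddr_eq0 ?sqr_ge0// !sqrf_eq0.
by rewrite eq_complex.
Qed.

Lemma sqmodV z : z != 0 -> sqmod z^-1 = (sqmod z)^-1.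
Proof.
move=> z0; apply: (@mulfI _ (sqmod z)); first by rewrite sqmod_eq0.
by rewrite -sqmodM !divff ?sqmod1// sqmod_eq0.
Qed.

Lemma sqmodC z : sqmod z^* = sqmod z.
Proof. by case: z => a b; rewrite /sqmod /= sqrrN. Qed.

Lemma sqmod_expi x : sqmod (expi x) = 1.
Proof. by rewrite /sqmod /= cos2Dsin2. Qed.

Lemma expiD x y : expi (x + y) = expi x * expi y.
Proof. by apply/eqP; rewrite eq_complex /= cosD sinD addrC eqxx addrC eqxx. Qed.

Lemma expi0 : expi 0 = 1 :> R[i].
Proof. by rewrite /expi cos0 sin0. Qed.

(** Both sides are nonnegative and [sqmod] is multiplicative, so squaring eliminates the square
    root. *)
Lemma sqmod_sqrtc_i x : sqmod (sqrtc ('i * x%:C)) = `|x|.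
Proof.
have sqi : sqmod ('i : R[i]) = 1.
  apply/eqP; rewrite -(@eqrXn2 _ 2) ?sqmod_ge0// expr2 -sqmodM -expr2 sqr_i.
  by rewrite /sqmod /= oppr0 expr0n addr0 sqrrN.
apply/eqP; rewrite -(@eqrXn2 _ 2) ?sqmod_ge0// expr2 -sqmodM -expr2 sqr_sqrtc.
by rewrite sqmodM sqi mul1r real_normK ?num_real// /sqmod /= expr0n addr0.
Qed.

Lemma sqmod_lct_kernel (a b d t u : R) : b != 0 ->
  sqmod (lct_kernel a b d t u) = (2 * pi * `|b|)^-1.
Proof.
move=> b0; rewrite /lct_kernel sqmodM sqmod_expi mulr1.
have N : sqmod (sqrtc ('i * (2 * pi * b)%:C)) = 2 * pi * `|b|.
  by rewrite sqmod_sqrtc_i normrM gtr0_norm// mulr_gt0// pi_gt0.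
rewrite sqmodV ?N// -sqmod_eq0 N mulf_neq0 ?normr_eq0//.
by rewrite gt_eqF// mulr_gt0// pi_gt0.
Qed.

End complex_lemmas.

(** * Complex integrals and Plancherel's identity *)

Section complex_integral.
Context {R : realType}.
Notation mu := (@lebesgue_measure R).
Notation L1 := (L1 mu).
Implicit Types (h k : R -> R[i]) (c : R[i]).

Definition cmeasurable d (T : measurableType d) (h : T -> R[i]) :=
  measurable_fun setT (fun x => complex.Re (h x)) /\
  measurable_fun setT (fun x => complex.Im (h x)).

Definition cL1 h := L1 (fun x => complex.Re (h x)) /\ L1 (fun x => complex.Im (h x)).

Lemma cReM (z w : R[i]) : complex.Re (z * w) =
  complex.Re z * complex.Re w - complex.Im z * complex.Im w.
Proof. by case: z w => [? ?] [? ?]. Qed.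

Lemma cImM (z w : R[i]) : complex.Im (z * w) =
  complex.Re z * complex.Im w + complex.Im z * complex.Re w.
Proof. by case: z w => [? ?] [? ?]. Qed.

Lemma cReB (z w : R[i]) : complex.Re (z - w) = complex.Re z - complex.Re w.
Proof. by case: z w => [? ?] [? ?]. Qed.

Lemma cImB (z w : R[i]) : complex.Im (z - w) = complex.Im z - complex.Im w.
Proof. by case: z w => [? ?] [? ?]. Qed.

Lemma cReC (z : R[i]) : complex.Re z^* = complex.Re z.
Proof. by case: z. Qed.

Lemma cImC (z : R[i]) : complex.Im z^* = - complex.Im z.
Proof. by case: z. Qed.

Lemma eq_complexP (z w : R[i]) :
  complex.Re z = complex.Re w -> complex.Im z = complex.Im w -> z = w.
Proof. by case: z w => [? ?] [? ?] /= -> ->. Qed.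

Section cmeasurable.
Context d (T : measurableType d).
Implicit Types (f g : T -> R[i]).

Lemma cmeasurableM f g : cmeasurable f -> cmeasurable g ->
  cmeasurable (fun x => f x * g x).
Proof.
move=> [f1 f2] [g1 g2]; split.
  by under eq_fun do rewrite cReM; mfun.
by under eq_fun do rewrite cImM; mfun.
Qed.

Lemma cmeasurableB f g : cmeasurable f -> cmeasurable g ->
  cmeasurable (fun x => f x - g x).
Proof.
move=> [f1 f2] [g1 g2]; split.
  by under eq_fun do rewrite cReB; mfun.
by under eq_fun do rewrite cImB; mfun.
Qed.

Lemma cmeasurableC f : cmeasurable f -> cmeasurable (fun x => (f x)^*).
Proof.
move=> [f1 f2]; split.
  by under eq_fun do rewrite cReC.
by under eq_fun do rewrite cImC; mfun.
Qed.

Lemma cmeasurable_cst c : cmeasurable (fun _ : T => c).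
Proof. by split; exact: measurable_cst. Qed.

Lemma cmeasurable_expi (th : T -> R) : measurable_fun setT th ->
  cmeasurable (fun x => expi (th x)).
Proof. by move=> mth; split; rewrite /expi /=; mfun. Qed.

Lemma measurable_sqmod f : cmeasurable f -> measurable_fun setT (fun x => sqmod (f x)).
Proof. by move=> [f1 f2]; rewrite /sqmod; mfun. Qed.

Lemma cmeasurable_comp d' (T' : measurableType d') f (phi : T' -> T) :
  cmeasurable f -> measurable_fun setT phi -> cmeasurable (fun x => f (phi x)).
Proof. by move=> [f1 f2] mphi; split;
  [exact: (measurableT_comp f1 mphi)|exact: (measurableT_comp f2 mphi)]. Qed.

End cmeasurable.

Lemma cL1_cmeasurable h : cL1 h -> cmeasurable h.
Proof. by move=> [h1 h2]; split; [exact: L1_measurable h1|exact: L1_measurable h2]. Qed.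

Lemma cL1_unimod h (th : R -> R) : cL1 h -> measurable_fun setT th ->
  cL1 (fun x => h x * expi (th x)).
Proof.
move=> [h1 h2] mth.
have mc : measurable_fun setT (fun x => cos (th x)) by mfun.
have ms : measurable_fun setT (fun x => sin (th x)) by mfun.
have bc x : `|cos (th x)| <= 1 by exact: cos_max.
have bs x : `|sin (th x)| <= 1 by exact: sin_max.
split.
  by under eq_fun do rewrite cReM; apply: L1B; apply: (@L1_bounded_mul _ _ _ _ 1).
by under eq_fun do rewrite cImM; apply: L1D; apply: (@L1_bounded_mul _ _ _ _ 1).
Qed.

Lemma cL1Z c h : cL1 h -> cL1 (fun x => c * h x).
Proof.
move=> [h1 h2]; split.
  by under eq_fun do rewrite cReM; apply: L1B; exact: L1Z.
by under eq_fun do rewrite cImM; apply: L1D; exact: L1Z.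
Qed.

Lemma cL1B h k : cL1 h -> cL1 k -> cL1 (fun x => h x - k x).
Proof.
move=> [h1 h2] [k1 k2]; split.
  by under eq_fun do rewrite cReB; exact: L1B.
by under eq_fun do rewrite cImB; exact: L1B.
Qed.

Lemma cL1_shift h (s : R) : cL1 h -> cL1 (fun x => h (x + s)).
Proof. by move=> [h1 h2]; split; [exact: (L1_shift s h1)|exact: (L1_shift s h2)]. Qed.

Lemma cintZ c h : cL1 h -> cint setT (fun x => c * h x) = c * cint setT h.
Proof.
move=> [h1 h2].
apply: eq_complexP; rewrite ?cReM ?cImM /cint /=.
  under eq_Rintegral do rewrite cReM.
  by rewrite RintegralB ?RintegralZl//; exact: L1Z.
under eq_Rintegral do rewrite cImM.
by rewrite RintegralD ?RintegralZl//; exact: L1Z.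
Qed.

Lemma cintB h k : cL1 h -> cL1 k ->
  cint setT (fun x => h x - k x) = cint setT h - cint setT k.
Proof.
move=> [h1 h2] [k1 k2]; apply: eq_complexP; rewrite ?cReB ?cImB /cint /=.
  by under eq_Rintegral do rewrite cReB; rewrite RintegralB.
by under eq_Rintegral do rewrite cImB; rewrite RintegralB.
Qed.

Lemma cint_shift h (s : R) : cL1 h -> cint setT (fun x => h (x + s)) = cint setT h.
Proof.
move=> [h1 h2]; apply: eq_complexP; rewrite /cint /=.
  exact: (Rintegral_shift s h1).
exact: (Rintegral_shift s h2).
Qed.

Lemma eq_cint h k : h =1 k -> cint setT h = cint setT k.
Proof. by move=> /funext ->. Qed.

Definition csq h := L1 (fun x => sqmod (h x)).

Lemma csq_sqr h : cmeasurable h -> csq h ->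
  L1 (fun x => complex.Re (h x) ^+ 2) /\ L1 (fun x => complex.Im (h x) ^+ 2).
Proof.
move=> [h1 h2] h3; split; apply: (L1_le _ h3); do ?by mfun.
  by move=> x; rewrite ger0_norm ?sqr_ge0// /sqmod lerDl sqr_ge0.
by move=> x; rewrite ger0_norm ?sqr_ge0// /sqmod lerDr sqr_ge0.
Qed.

Definition fourier h (t : R) := cint setT (fun x => h x * expi (- (x * t))).

Lemma fourierE h (t : R) : cL1 h ->
  fourier h t = (cos_transform (fun x => complex.Re (h x)) t +
                 sin_transform (fun x => complex.Im (h x)) t) +i*
                (cos_transform (fun x => complex.Im (h x)) t -
                 sin_transform (fun x => complex.Re (h x)) t).
Proof.
move=> [h1 h2]; apply: eq_complexP; rewrite /fourier /cint /=.
  rewrite -RintegralD//; [|exact: L1_cos|exact: L1_sin].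
  by apply: eq_Rintegral => x _; rewrite cReM /= cosN sinN; ring.
rewrite -RintegralB//; [|exact: L1_cos|exact: L1_sin].
by apply: eq_Rintegral => x _; rewrite cImM /= cosN sinN; ring.
Qed.

(* Averaging over t and -t kills the cross terms, which are odd in t. *)
Lemma plancherel h : cL1 h -> csq h ->
  (\int[mu]_t (sqmod (fourier h t))%:E = (2 * pi)%:E * \int[mu]_x (sqmod (h x))%:E)%E.
Proof.
move=> hi h2; have mh := cL1_cmeasurable hi.
have [re2 im2] := csq_sqr mh h2.
have [hr hI] := hi; have [mr mi] := mh.
set p := (fun x => complex.Re (h x)) in hr mr re2.
set q := (fun x => complex.Im (h x)) in hI mi im2.
pose C1 := cos_transform p; pose S1 := sin_transform p.
pose C2 := cos_transform q; pose S2 := sin_transform q.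
have mC1 : measurable_fun setT C1 by exact: measurable_cos_transform.
have mS1 : measurable_fun setT S1 by exact: measurable_sin_transform.
have mC2 : measurable_fun setT C2 by exact: measurable_cos_transform.
have mS2 : measurable_fun setT S2 by exact: measurable_sin_transform.
have CN (r : R -> R) (t : R) : cos_transform r (- t) = cos_transform r t.
  by apply: eq_Rintegral => x _; rewrite mulrN cosN.
have SN (r : R -> R) (t : R) : L1 r -> sin_transform r (- t) = - sin_transform r t.
  move=> ri; rewrite -[RHS]mulN1r /sin_transform -RintegralZl//; last exact: L1_sin.
  by apply: eq_Rintegral => x _; rewrite mulrN sinN; ring.
pose G t := sqmod (fourier h t).
have GE t : G t = (C1 t + S2 t) ^+ 2 + (C2 t - S1 t) ^+ 2.
  by rewrite /G (fourierE _ hi).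
have mG : measurable_fun setT G.
  by rewrite (funext GE); mfun.
have G0 t : 0 <= G t by exact: sqmod_ge0.
have GN t : G (- t) = (C1 t - S2 t) ^+ 2 + (C2 t + S1 t) ^+ 2.
  by rewrite GE /C1 /C2 /S1 /S2 !CN !SN// opprK.
have IN : (\int[mu]_t (G (- t))%:E = \int[mu]_t (G t)%:E)%E.
  have n1 : (-1 : R) != 0 by rewrite oppr_eq0 oner_eq0.
  rewrite [RHS](@ge0_integral_affine R 0 (-1) n1)//; last exact/measurable_EFinP.
  by rewrite normrN normr1 mul1e; apply: eq_integral => t _; rewrite add0r mulN1r.
have P1 : (\int[mu]_t (C1 t ^+ 2 + S1 t ^+ 2)%:E = _)%E := plancherel_real hr re2.
have P2 : (\int[mu]_t (C2 t ^+ 2 + S2 t ^+ 2)%:E = _)%E := plancherel_real hI im2.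
rewrite -[LHS]/(\int[mu]_t (G t)%:E)%E.
clearbody C1 S1 C2 S2 G.
have D : (\int[mu]_t (G t)%:E + \int[mu]_t (G (- t))%:E =
   2%:E * ((\int[mu]_t (C1 t ^+ 2 + S1 t ^+ 2)%:E +
            \int[mu]_t (C2 t ^+ 2 + S2 t ^+ 2)%:E)))%E.
  transitivity (\int[mu]_t ((G t)%:E + (G (- t))%:E))%E.
    apply/esym; apply: ge0_integralD; first exact: measurableT.
    - by move=> t _; rewrite lee_fin.
    - exact/measurable_EFinP.
    - by move=> t _; rewrite lee_fin.
    - by apply/measurable_EFinP; apply: (measurableT_comp mG).
  transitivity (2%:E * \int[mu]_t ((C1 t ^+ 2 + S1 t ^+ 2)%:E +
      (C2 t ^+ 2 + S2 t ^+ 2)%:E))%E; last first.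
    congr (_ * _)%E; apply: ge0_integralD; first exact: measurableT.
    - by move=> t _; rewrite lee_fin addr_ge0// sqr_ge0.
    - by apply/measurable_EFinP; mfun.
    - by move=> t _; rewrite lee_fin addr_ge0// sqr_ge0.
    - by apply/measurable_EFinP; mfun.
  rewrite -ge0_integralZl//.
  - apply: eq_integral => t _; rewrite -!EFinD -EFinM; congr EFin.
    by rewrite GN GE; ring.
  - by apply: emeasurable_funD; apply/measurable_EFinP; mfun.
  - by move=> t _; rewrite -EFinD lee_fin !addr_ge0// sqr_ge0.
move: D; rewrite IN P1 P2 => D.
have NE : (\int[mu]_x (sqmod (h x))%:E =
    (\int[mu]_x (p x ^+ 2) + \int[mu]_x (q x ^+ 2))%:E)%E.
  by rewrite (L1_fineK h2) -RintegralD.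
rewrite NE -EFinM; move: D; rewrite -EFinD -EFinM.
have : (0 <= \int[mu]_t (G t)%:E)%E by apply: integral_ge0 => t _; rewrite lee_fin.
case: (\int[mu]_t (G t)%:E)%E => //= r _ [] rE; congr EFin; lra.
Qed.

End complex_integral.

(** * The LCT of an integrable signal *)

Section lct.
Context {R : realType}.
Notation mu := (@lebesgue_measure R).
Notation L1 := (L1 mu).
Implicit Types (h k : R -> R[i]).

Lemma cmeasurable_cint d (T : measurableType d) (F : T * R -> R[i]) :
  cmeasurable F -> cmeasurable (fun x => cint setT (fun y => F (x, y))).
Proof.
move=> [F1 F2]; split; rewrite /cint /=.
  exact: (@measurable_fun_Rintegral _ _ _ (measurableTypeR R) _ mu
    (fun z => complex.Re (F z))).
exact: (@measurable_fun_Rintegral _ _ _ (measurableTypeR R) _ mu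
  (fun z => complex.Im (F z))).
Qed.

(** The absolutely convergent LCT, meant for integrable [h]. By unfolding, [stlct] at time t is this
    transform of the windowed signal. *)
Definition lct (a b d : R) h (u : R) := cint setT (fun x => h x * lct_kernel a b d x u).

Lemma cmeasurable_lct_kernel d (T : measurableType d) (a b c : R) (x u : T -> R) :
  measurable_fun setT x -> measurable_fun setT u ->
  cmeasurable (fun z => lct_kernel a b c (x z) (u z)).
Proof.
move=> mx mu'; apply: cmeasurableM; first exact: cmeasurable_cst.
by apply: cmeasurable_expi; mfun.
Qed.

Lemma cmeasurable_lct (a b d : R) h : cmeasurable h -> cmeasurable (lct a b d h).
Proof.
move=> mh; apply: (@cmeasurable_cint _ _ (fun z : R * R => h z.2 * lct_kernel a b d z.2 z.1)).
apply: cmeasurableM; first exact: (cmeasurable_comp mh measurable_snd).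
by apply: cmeasurable_lct_kernel; mfun.
Qed.

Lemma cmeasurable_fourier h : cmeasurable h -> cmeasurable (fourier h).
Proof.
move=> mh; apply: (@cmeasurable_cint _ _ (fun z : R * R => h z.2 * expi (- (z.2 * z.1)))).
apply: cmeasurableM; first exact: (cmeasurable_comp mh measurable_snd).
by apply: cmeasurable_expi; mfun.
Qed.

Lemma csq_unimod h (th : R -> R) : csq h -> csq (fun x => h x * expi (th x)).
Proof. by apply: eq_L1 => x; rewrite sqmodM sqmod_expi mulr1. Qed.

Lemma cL1_lct_kernel (a b d u : R) h : cL1 h -> cL1 (fun x => h x * lct_kernel a b d x u).
Proof.
move=> hi; rewrite /lct_kernel.
under eq_fun do rewrite mulrCA.
by apply: cL1Z; apply: cL1_unimod => //; mfun.
Qed.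

(** The kernel factors as chirp, Fourier kernel at frequency u/b, chirp; the chirp in [u] and the
    normalizing constant are collected in [lct_kernel a b d 0 u]. *)
Lemma lct_fourier (a b d u : R) h : b != 0 -> cL1 h ->
  lct a b d h u = lct_kernel a b d 0 u *
    fourier (fun x => h x * expi (a / (2 * b) * x ^+ 2)) (b^-1 * u).
Proof.
move=> b0 hi; rewrite /fourier -cintZ; last first.
  apply: cL1_unimod; last by mfun.
  by apply: cL1_unimod => //; mfun.
apply: eq_cint => x; rewrite /lct_kernel.
set c := _^-1; rewrite mulrCA -[RHS]mulrA; congr (c * _).
rewrite -(mulrA (h x)) -expiD [RHS]mulrCA -expiD; congr (_ * expi _).
by field.
Qed.

(** The squared modulus 1/(2 pi |b|) of the kernel cancels the 2 pi of the Fourier identity and the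
    Jacobian |b| of the scaling u/b. *)
Lemma lct_plancherel (a b d : R) h : b != 0 -> cL1 h -> csq h ->
  (\int[mu]_u (sqmod (lct a b d h u))%:E = \int[mu]_x (sqmod (h x))%:E)%E.
Proof.
move=> b0 hi h2; set k := fun x => h x * expi (a / (2 * b) * x ^+ 2).
have ki : cL1 k by apply: cL1_unimod => //; mfun.
have k2 : csq k by exact: csq_unimod.
have B0 : 0 < `|b| by rewrite normr_gt0.
have p0 : 0 < 2 * pi * `|b| by rewrite !mulr_gt0// pi_gt0.
have b1 : b^-1 != 0 by rewrite invr_eq0.
pose G t := sqmod (fourier k t).
have mG : measurable_fun setT G.
  exact: measurable_sqmod (cmeasurable_fourier (cL1_cmeasurable ki)).
have G0 t : 0 <= G t by exact: sqmod_ge0.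
have GI : (\int[mu]_t (G t)%:E = (2 * pi)%:E * \int[mu]_x (sqmod (h x))%:E)%E.
  rewrite /G plancherel//; congr (_ * _)%E.
  by apply: eq_integral => x _; rewrite /k sqmodM sqmod_expi mulr1.
have GL u : sqmod (lct a b d h u) = (2 * pi * `|b|)^-1 * G (0 + b^-1 * u).
  by rewrite lct_fourier// sqmodM sqmod_lct_kernel// add0r.
clearbody G.
have I : (\int[mu]_t (G t)%:E = _)%E := @ge0_integral_affine R 0 b^-1 b1
  (fun t => (G t)%:E) ltac:(exact/measurable_EFinP) ltac:(by move=> t; rewrite lee_fin).
under eq_integral do rewrite GL EFinM.
rewrite ge0_integralZl//.
- move: I; rewrite GI (L1_fineK h2) normfV.
  have : (0 <= \int[mu]_u (G (0 + b^-1 * u))%:E)%E.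
    by apply: integral_ge0 => t _; rewrite lee_fin.
  case: (\int[mu]_u (G (0 + b^-1 * u))%:E)%E => //= [r _|_].
    rewrite -!EFinM => -[rE]; congr EFin.
    rewrite (_ : r = `|b| * (`|b|^-1 * r)); last by rewrite mulVKf ?gt_eqF.
    have pin : (pi : R) != 0 by rewrite gt_eqF// pi_gt0.
    have bn : `|b| != 0 by rewrite gt_eqF.
    by rewrite -rE; move: (pi : R) pin => P pin; field; rewrite pin bn.
  by rewrite gt0_muley// lte_fin invr_gt0.
- by apply/measurable_EFinP; apply: (measurableT_comp mG); mfun.
- by move=> t _; rewrite lee_fin.
- by rewrite lee_fin invr_ge0 ltW.
Qed.

End lct.

(** * Elementary bounds for sine and cosine *)

Section trigonometric_bounds.
Context {R : realType}.
Implicit Types x : R.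

Let sin_MVT x : 0 < x -> exists2 c, 0 < c < x & sin x = cos c * x.
Proof.
move=> x0; have cs : {within `[0, x], continuous (@sin R)}.
  by apply: continuous_subspaceT; exact: continuous_sin.
have [c cx E] := MVT x0 (fun y _ => is_derive_sin y) cs.
by exists c; [move: cx; rewrite in_itv|rewrite sin0 !subr0 in E].
Qed.

Lemma normr_sin_le x : `|sin x| <= `|x|.
Proof.
wlog x0 : x / 0 < x.
  move=> H; have [/H//|xn|<-] := ltgtP 0 x; last by rewrite sin0.
  by rewrite -normrN -sinN -[leRHS]normrN; apply: H; rewrite oppr_gt0.
have [c _ ->] := sin_MVT x0.
by rewrite normrM ler_piMl// cos_max.
Qed.

Lemma cos_ge x : 1 - x ^+ 2 / 2 <= cos x.
Proof.
rewrite (_ : x = x / 2 + x / 2); last by field.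
rewrite cosD -!expr2; have := cos2Dsin2 (x / 2).
have : sin (x / 2) ^+ 2 <= (x / 2) ^+ 2.
  rewrite -[leLHS]real_normK ?num_real// -[leRHS]real_normK ?num_real//.
  by rewrite ler_pXn2r ?nnegrE// normr_sin_le.
set s := sin _; set c := cos _; rewrite !expr2; nra.
Qed.

(** For x at least 1 the left side is nonpositive. Below 1, sin x = x cos c with c < x, and cos c is
    at least 1 - c^2/2, where c^2 is at most x. *)
Lemma normr_sin_ge x : `|x| - x ^+ 2 <= `|sin x|.
Proof.
wlog x0 : x / 0 < x.
  move=> H; have [/H//|xn|<-] := ltgtP 0 x.
    by rewrite -normrN -sqrrN -[leRHS]normrN -sinN; apply: H; rewrite oppr_gt0.
  by rewrite sin0 normr0 expr0n subrr.
have [x1|x1] := leP 1 x.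
  apply: le_trans (normr_ge0 _); rewrite gtr0_norm// subr_le0 expr2.
  by rewrite ler_peMl// ltW.
have [c /andP[c0 cx] ->] := sin_MVT x0.
apply: le_trans (ler_norm _); rewrite gtr0_norm//.
have := cos_ge c; have : c ^+ 2 <= x by nra.
rewrite !expr2; nra.
Qed.

End trigonometric_bounds.

(** * Inner products and squared norms *)

Section inner_product.
Context {R : realType}.
Notation mu := (@lebesgue_measure R).
Notation L1 := (L1 mu).
Implicit Types (f g h k : R -> R[i]).

Definition cL2 h := cmeasurable h /\ csq h.

Definition cip h k := cint setT (fun x => h x * (k x)^*).

Definition sqnorm h := \int[mu]_x (sqmod (h x)).

Lemma sqnorm_ge0 h : 0 <= sqnorm h.
Proof. by apply: Rintegral_ge0 => x _; exact: sqmod_ge0. Qed.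

Lemma cL1_cip h k : cL2 h -> cL2 k -> cL1 (fun x => h x * (k x)^*).
Proof.
move=> [mh h2] [mk k2].
have [hr hi] := csq_sqr mh h2; have [kr ki] := csq_sqr mk k2.
have [mhr mhi] := mh; have [mkr mki] := mk; split.
  under eq_fun do rewrite cReM cReC cImC mulrN opprK.
  by apply: L1D; apply: L1_mul.
under eq_fun do rewrite cImM cReC cImC mulrN addrC.
by apply: L1B; apply: L1_mul.
Qed.

Lemma cL2B h k : cL2 h -> cL2 k -> cL2 (fun x => h x - k x).
Proof.
move=> [mh h2] [mk k2]; have mhk := cmeasurableB mh mk; split => //.
apply: (L1_le _ (L1Z 2 (L1D h2 k2))); first exact: measurable_sqmod.
move=> x; rewrite ger0_norm ?sqmod_ge0// /sqmod cReB cImB.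
have := sqr_ge0 (complex.Re (h x) + complex.Re (k x)).
have := sqr_ge0 (complex.Im (h x) + complex.Im (k x)).
by rewrite !expr2; lra.
Qed.

Lemma cipBl f h k : cL2 f -> cL2 h -> cL2 k ->
  cip (fun x => f x - h x) k = cip f k - cip h k.
Proof.
move=> hf hh hk; rewrite /cip -cintB; [|exact: cL1_cip|exact: cL1_cip].
by apply: eq_cint => x; rewrite mulrBl.
Qed.

Lemma cipBr f h k : cL2 f -> cL2 h -> cL2 k ->
  cip k (fun x => f x - h x) = cip k f - cip k h.
Proof.
move=> hf hh hk; rewrite /cip -cintB; [|exact: cL1_cip|exact: cL1_cip].
by apply: eq_cint => x; rewrite rmorphB mulrBr.
Qed.

Lemma cipZl (c : R[i]) h k : cL2 h -> cL2 k ->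
  cip (fun x => c * h x) k = c * cip h k.
Proof.
move=> hh hk; rewrite /cip -cintZ; last exact: cL1_cip.
by apply: eq_cint => x; rewrite mulrA.
Qed.

(** This takes the place of Cauchy-Schwarz: the weight [l] keeps the bound linear in the squared
    norms. *)
Lemma normr_Im_cip_le (l : R) h k : 0 < l -> cL2 h -> cL2 k ->
  `|complex.Im (cip h k)| <= (l * sqnorm h + l^-1 * sqnorm k) / 2.
Proof.
move=> l0 hh hk; have [_ I] := cL1_cip hh hk.
have [mh h2] := hh; have [mk k2] := hk.
rewrite /cip /cint [complex.Im _]/=.
apply: le_trans (le_normr_Rintegral _ I) _ => //.
rewrite mulrC /sqnorm.
have h2' := L1Z l h2; have k2' := L1Z l^-1 k2.
rewrite -!RintegralZl// -RintegralD// -RintegralZl//; last exact: L1D.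
apply: le_Rintegral => //.
- exact: L1_norm.
- by apply: L1Z; exact: L1D.
move=> x _; rewrite cImM cReC cImC mulrN.
case: (h x) => a b; case: (k x) => c d /=; rewrite /sqmod /=.
(* The sign [e] treats both halves of the absolute value at once; the difference of the two sides is
   a sum of squares modulo e^2 = 1. *)
have key (e : R) : e ^+ 2 = 1 -> e * (- (a * d) + b * c) <=
    2^-1 * (l * (a ^+ 2 + b ^+ 2) + l^-1 * (c ^+ 2 + d ^+ 2)).
  move=> e1; rewrite -subr_ge0.
  have -> : 2^-1 * (l * (a ^+ 2 + b ^+ 2) + l^-1 * (c ^+ 2 + d ^+ 2)) -
      e * (- (a * d) + b * c) =
      l / 2 * ((a + l^-1 * e * d) ^+ 2 + (b - l^-1 * e * c) ^+ 2) +
      (1 - e ^+ 2) * l^-1 / 2 * (c ^+ 2 + d ^+ 2) by field; rewrite gt_eqF.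
  rewrite e1 subrr !mul0r addr0; apply: mulr_ge0.
    by rewrite ltW// divr_gt0.
  by rewrite addr_ge0 ?sqr_ge0.
rewrite ler_norml; apply/andP; split.
  by rewrite lerNl -[leLHS]mulN1r; apply: key; rewrite sqrrN expr1n.
by have := key 1 (expr1n _ _); rewrite mul1r.
Qed.

Lemma sqnormB h k : cL2 h -> cL2 k ->
  sqnorm (fun x => h x - k x) = sqnorm h + sqnorm k - 2 * complex.Re (cip h k).
Proof.
move=> hh hk; have [I _] := cL1_cip hh hk.
have [mh h2] := hh; have [mk k2] := hk.
rewrite /cip /cint [complex.Re _]/= /sqnorm.
have hk2 := L1D h2 k2; have I2 := L1Z 2 I.
rewrite -RintegralZl// -RintegralD// -RintegralB//.
apply: eq_Rintegral => x _; rewrite cReM cReC cImC.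
by case: (h x) => a b; case: (k x) => c d /=; rewrite /sqmod /=; ring.
Qed.

Lemma sqnormD_le h k : cL2 h -> cL2 k ->
  sqnorm (fun x => h x - k x) <= 2 * (sqnorm h + sqnorm k).
Proof.
move=> hh hk; have [mhk hk2] := cL2B hh hk.
have [mh h2] := hh; have [mk k2] := hk; have h2k2 := L1D h2 k2.
rewrite /sqnorm -RintegralD// -RintegralZl//.
apply: le_Rintegral => //; first exact: L1Z.
move=> x _; rewrite /sqmod cReB cImB.
have := sqr_ge0 (complex.Re (h x) + complex.Re (k x)).
have := sqr_ge0 (complex.Im (h x) + complex.Im (k x)).
by rewrite !expr2; lra.
Qed.

End inner_product.

(** * Weyl operators *)

Section weyl.
Context {R : realType}.
Notation mu := (@lebesgue_measure R).
Notation L1 := (L1 mu).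
Implicit Types (f g h k : R -> R[i]).

(* The unitary group exp(i s (U - m)) generated by the centred position operator
   U = a x - i b d/dx of the LCT domain. *)
Definition weyl (a b m s : R) h (x : R) : R[i] :=
  h (x + b * s) * expi (a * s * x + a * b / 2 * s ^+ 2 - s * m).

Variables (a b m s : R).

Lemma cL1_weyl h : cL1 h -> cL1 (weyl a b m s h).
Proof.
by move=> hi; apply: cL1_unimod; [exact: cL1_shift|mfun].
Qed.

Lemma cL2_weyl h : cL2 h -> cL2 (weyl a b m s h).
Proof.
move=> [mh h2]; split.
  apply: cmeasurableM; first by apply: (cmeasurable_comp mh); mfun.
  by apply: cmeasurable_expi; mfun.
by apply: csq_unimod; exact: (L1_shift (b * s) h2).
Qed.

Lemma expi_conj (x : R) : expi x * (expi x)^* = 1.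
Proof.
apply: eq_complexP; rewrite ?cReM ?cImM cReC cImC /=; last by ring.
by rewrite -(cos2Dsin2 x); ring.
Qed.

Lemma cip_weyl h k : cL2 h -> cL2 k ->
  cip (weyl a b m s h) (weyl a b m s k) = cip h k.
Proof.
move=> hh hk; rewrite /cip -(cint_shift (b * s) (cL1_cip hh hk)).
apply: eq_cint => x; rewrite /weyl rmorphM mulrACA expi_conj mulr1//.
Qed.

Lemma sqnorm_weyl h : cL2 h -> sqnorm (weyl a b m s h) = sqnorm h.
Proof.
move=> [mh h2]; rewrite /sqnorm -(Rintegral_shift (b * s) h2).
by apply: eq_Rintegral => x _; rewrite /weyl sqmodM sqmod_expi mulr1.
Qed.

(** The inner chirp, evaluated at the translated point, contributes the phase -a b s^2; the two
    quadratic phases a b s^2 / 2 cancel it. *)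
Lemma weylK h : weyl a b m s (weyl a b m (- s) h) = h.
Proof.
apply/funext => x; rewrite /weyl -mulrA -expiD.
rewrite (_ : _ + b * - s = x); last by ring.
rewrite [X in expi X](_ : _ = 0) ?expi0 ?mulr1//.
by field.
Qed.

(** After the substitution of x + b s for x on the right, the cross term and the square in the
    kernel's exponent yield exactly the phases built into [weyl]. *)
Lemma lct_weyl (d u : R) h : b != 0 -> cL1 h ->
  lct a b d (weyl a b m s h) u = expi (s * (u - m)) * lct a b d h u.
Proof.
move=> b0 hi; rewrite /lct.
rewrite -(cint_shift (b * s) (cL1_lct_kernel a b d u hi)) -cintZ; last first.
  exact: cL1_shift (cL1_lct_kernel a b d u hi).
apply: eq_cint => x; rewrite /weyl /lct_kernel.
set c := (sqrtc _)^-1; rewrite -mulrA [RHS]mulrCA; congr (_ * _).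
rewrite mulrCA [RHS]mulrCA; congr (_ * _); rewrite -!expiD; congr expi.
by field.
Qed.

End weyl.

Lemma sqmod_expiB1_le (R : realType) (x : R) : sqmod (expi x - 1) <= x ^+ 2.
Proof.
rewrite /sqmod cReB cImB /= subr0.
have -> : (cos x - 1) ^+ 2 + sin x ^+ 2 = 2 * (1 - cos x).
  by have := cos2Dsin2 x; rewrite !expr2; nra.
by have := cos_ge x; lra.
Qed.

(** On the LCT side the increment is multiplication by [expi (s * (u - m)) - 1], whose squared
    modulus is at most s^2 (u - m)^2. *)
Lemma sqnorm_weylB_le (R : realType) (a b d m s V : R) (h : R -> R[i]) :
  b != 0 -> cL1 h -> csq h ->
  (\int[@lebesgue_measure R]_u ((u - m) ^+ 2 * sqmod (lct a b d h u))%:E = V%:E)%E ->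
  sqnorm (fun x => weyl a b m s h x - h x) <= s ^+ 2 * V.
Proof.
move=> b0 hi h2 VE.
have hh : cL2 h by split => //; exact: cL1_cmeasurable.
have hW := cL2_weyl a b m s hh; have iW := cL1_weyl a b m s hi.
have [mk k2] := cL2B hW hh; have ik := cL1B iW hi.
pose G u := sqmod (lct a b d h u).
have mG : measurable_fun setT G.
  by apply: measurable_sqmod; apply: cmeasurable_lct; exact: cL1_cmeasurable.
have G0 u : 0 <= G u by exact: sqmod_ge0.
pose F u := sqmod (lct a b d (fun x => weyl a b m s h x - h x) u).
have mF : measurable_fun setT F by apply: measurable_sqmod; exact: cmeasurable_lct.
have F0 u : 0 <= F u by exact: sqmod_ge0.
have FG u : F u <= s ^+ 2 * ((u - m) ^+ 2 * G u).
  rewrite /F; have -> : lct a b d (fun x => weyl a b m s h x - h x) u =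
      (expi (s * (u - m)) - 1) * lct a b d h u.
    rewrite mulrBl mul1r -lct_weyl// /lct -cintB; last 2 first.
      exact: cL1_lct_kernel.
      exact: cL1_lct_kernel.
    by apply: eq_cint => x; rewrite mulrBl.
  rewrite sqmodM mulrA -exprMn ler_wpM2r ?sqmod_ge0//.
  exact: sqmod_expiB1_le.
rewrite -lee_fin /sqnorm -(L1_fineK k2) -(@lct_plancherel _ a b d)// EFinM -VE.
rewrite -[X in (_ * X)%E]/(\int[@lebesgue_measure R]_u ((u - m) ^+ 2 * G u)%:E)%E.
rewrite -[X in (X <= _)%E]/(\int[@lebesgue_measure R]_u (F u)%:E)%E.
clearbody F G.
have mR : measurable_fun setT (fun u : R => (u - m) ^+ 2 * G u) by mfun.
rewrite -ge0_integralZl//; last 3 first.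
- exact/measurable_EFinP.
- by move=> u _; rewrite lee_fin mulr_ge0 ?sqr_ge0.
- by rewrite lee_fin sqr_ge0.
apply: ge0_le_integral => //.
- by move=> u _; rewrite lee_fin.
- exact/measurable_EFinP.
- by apply: emeasurable_funM => //; exact/measurable_EFinP.
- by move=> u _; rewrite -EFinM lee_fin; exact: FG.
Qed.

(** * The uncertainty inequality for one signal *)

Section uncertainty.
Context {R : realType}.
Notation mu := (@lebesgue_measure R).
Variables (a1 b1 d1 m1 a2 b2 d2 m2 : R).

Let A s := weyl a1 b1 m1 s.
Let B s := weyl a2 b2 m2 s.
Let delta := a1 * b2 - a2 * b1.

(** Each chirp is evaluated at a point translated by the other operator when it acts first; the
    phases a1 b2 s^2 and a2 b1 s^2 so created are the only mismatch. *)
Lemma weyl_commutation (s : R) (h : R -> R[i]) :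
  B s (A s h) = (fun x => expi (delta * s ^+ 2) * A s (B s h) x).
Proof.
apply/funext => x; rewrite /A /B /weyl.
rewrite (_ : x + b2 * s + b1 * s = x + b1 * s + b2 * s); last by ring.
rewrite -!mulrA -!expiD [RHS]mulrCA -expiD; congr (_ * expi _).
by rewrite /delta; field.
Qed.

(** The adjoint of [A s] is [A (- s)], and likewise for [B], so the left side is the matrix element
    at [h] of the commutator of A - 1 and B - 1, that is of A B - B A. Subtracting the identity
    leaves the commutator unchanged while making every factor small. *)
Lemma weyl_commutator (s : R) (h : R -> R[i]) : cL2 h ->
  cip (fun x => B s h x - h x) (fun x => A (- s) h x - h x) -
  cip (fun x => A s h x - h x) (fun x => B (- s) h x - h x) =
  (1 - expi (delta * s ^+ 2)) * cip (A s (B s h)) h.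
Proof.
move=> hh.
have hA t : cL2 (A t h) by exact: cL2_weyl.
have hB t : cL2 (B t h) by exact: cL2_weyl.
have hAB : cL2 (A s (B s h)) by exact: cL2_weyl.
(* Adjoints are used by applying a unitary to both arguments and cancelling it on the right with
   [weylK]. *)
have e1 : cip (B s h) (A (- s) h) = cip (A s (B s h)) h.
  by rewrite -(cip_weyl a1 b1 m1 s (hB s) (hA (- s))) weylK.
have e2 : cip (A s h) (B (- s) h) = expi (delta * s ^+ 2) * cip (A s (B s h)) h.
  rewrite -(cip_weyl a2 b2 m2 s (hA s) (hB (- s))) weylK.
  by rewrite -/(B s (A s h)) weyl_commutation cipZl.
have e3 : cip h (A (- s) h) = cip (A s h) h.
  by rewrite -(cip_weyl a1 b1 m1 s hh (hA (- s))) weylK.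
have e4 : cip h (B (- s) h) = cip (B s h) h.
  by rewrite -(cip_weyl a2 b2 m2 s hh (hB (- s))) weylK.
rewrite !cipBl ?cipBr//; try by apply: cL2B.
by rewrite e1 e2 e3 e4; ring.
Qed.

Lemma lct_uncertainty_fin (h : R -> R[i]) (V1 V2 l : R) :
  b1 != 0 -> b2 != 0 -> cL1 h -> csq h -> 0 < l ->
  (\int[mu]_u ((u - m1) ^+ 2 * sqmod (lct a1 b1 d1 h u))%:E = V1%:E)%E ->
  (\int[mu]_u ((u - m2) ^+ 2 * sqmod (lct a2 b2 d2 h u))%:E = V2%:E)%E ->
  `|delta| * sqnorm h <= l * V2 + l^-1 * V1.
Proof.
move=> b10 b20 hi h2 l0 VE1 VE2.
have hh : cL2 h by split => //; exact: cL1_cmeasurable.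
have hA t : cL2 (A t h) by exact: cL2_weyl.
have hB t : cL2 (B t h) by exact: cL2_weyl.
have NA t : sqnorm (fun x => A t h x - h x) <= t ^+ 2 * V1.
  exact: sqnorm_weylB_le VE1.
have NB t : sqnorm (fun x => B t h x - h x) <= t ^+ 2 * V2.
  exact: sqnorm_weylB_le VE2.
have V10 : 0 <= V1 by have := le_trans (sqnorm_ge0 _) (NA 1); rewrite expr1n mul1r.
have V20 : 0 <= V2 by have := le_trans (sqnorm_ge0 _) (NB 1); rewrite expr1n mul1r.
set n := sqnorm h; have n0 : 0 <= n by exact: sqnorm_ge0.
set Q := l * V2 + l^-1 * V1.
have lV : 0 < l^-1 by rewrite invr_gt0.
(* After division by s^2, [K] collects the errors: the first term from replacing Re z by n, the
   second from sin and cos, which together cost 3/2, rounded up to 2. *)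
pose K := `|delta| * (V1 + V2) + 2 * `|delta| ^+ 2 * n.
have K0 : 0 <= K.
  by rewrite addr_ge0// mulr_ge0 ?addr_ge0// mulr_ge0// sqr_ge0.
suff main s : 0 < s -> `|delta| * n <= Q + s ^+ 2 * K.
  apply/ler_addgt0Pr => e e0.
  (* With s at most 1, s^2 K is at most s K, hence at most e; [K + 1] keeps the denominator
     positive. *)
  pose s := Num.min 1 (e / (K + 1)).
  have K1 : 0 < K + 1 by rewrite ltr_wpDl.
  have s0 : 0 < s by rewrite lt_min ltr01 divr_gt0.
  apply: le_trans (main s s0) _; rewrite lerD2l.
  have s1 : s <= 1 by rewrite ge_min lexx.
  have : s * (K + 1) <= e.
    by rewrite -ler_pdivlMr// ge_min lexx orbT.
  have : s ^+ 2 * K <= s * K.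
    by rewrite ler_wpM2r// expr2 ler_piMl// ltW.
  by rewrite (mulrDr s K 1) mulr1; lra.
move=> s0; pose z := cip (A s (B s h)) h; pose be := delta * s ^+ 2.
have hAB : cL2 (A s (B s h)) by exact: cL2_weyl.
have nAB : sqnorm (A s (B s h)) = n by rewrite /A /B !sqnorm_weyl.
have Imz : `|complex.Im z| <= n.
  have := @normr_Im_cip_le R 1 _ _ ltr01 hAB hh; rewrite nAB -/n -/z invr1; lra.
have zE : cip (B s h) (A (- s) h) = z.
  by rewrite -(cip_weyl a1 b1 m1 s (hB s) (hA (- s))) weylK.
have hA' := cL2B (hA (- s)) hh; have hB' := cL2B (hB s) hh.
have hA'' := cL2B (hA s) hh; have hB'' := cL2B (hB (- s)) hh.
(* Both [B s h] and [A (- s) h] have squared norm n and lie close to [h]. Expanding the squared norm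
   of their difference gives 2n - 2 Re z, which is at most twice the sum of the two squared
   increments. *)
have Rez : n - s ^+ 2 * (V1 + V2) <= complex.Re z.
  have D1 := sqnormB (hB s) (hA (- s)).
  have D2 := sqnormD_le hB' hA'.
  have E : (fun x => (B s h x - h x) - (A (- s) h x - h x)) =
      (fun x => B s h x - A (- s) h x) by apply/funext => x; ring.
  rewrite E D1 zE in D2.
  have nA : sqnorm (A (- s) h) = n by exact: sqnorm_weyl.
  have nB : sqnorm (B s h) = n by exact: sqnorm_weyl.
  have := NA (- s); have := NB s; rewrite nA nB sqrrN in D2 *; lra.
have := weyl_commutator s hh; rewrite -/z -/be => comm.
have I1 := normr_Im_cip_le l0 hB' hA'.
(* Here the [A] increment comes first, so the weight is inverted: both bounds then carry [l] on [V2]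
   and [l^-1] on [V1]. *)
have I2 := normr_Im_cip_le lV hA'' hB''; rewrite invrK in I2.
(* The imaginary part isolates the leading term: sin(be) Re z is close to delta s^2 n, while (1 -
   cos be) Im z has order s^4. *)
have {comm} comm : complex.Im (cip (fun x => B s h x - h x) (fun x => A (- s) h x - h x)) -
    complex.Im (cip (fun x => A s h x - h x) (fun x => B (- s) h x - h x)) =
    (1 - cos be) * complex.Im z - sin be * complex.Re z.
  by rewrite -cImB comm cImM cReB cImB /=; ring.
have J : `|(1 - cos be) * complex.Im z - sin be * complex.Re z| <= s ^+ 2 * Q.
  rewrite -comm; apply: le_trans (ler_normB _ _) _.
  apply: le_trans (lerD I1 I2) _.
  have f1 := ler_wpM2l (ltW l0) (NB s); have f2 := ler_wpM2l (ltW lV) (NA (- s)).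
  have f3 := ler_wpM2l (ltW lV) (NA s); have f4 := ler_wpM2l (ltW l0) (NB (- s)).
  rewrite sqrrN in f2 f4; rewrite /Q.
  by rewrite !mulrDr [s ^+ 2 * (l * _)]mulrCA [s ^+ 2 * (l^-1 * _)]mulrCA; lra.
have bE : `|be| = `|delta| * s ^+ 2 by rewrite /be normrM (ger0_norm (sqr_ge0 s)).
have S1 := normr_sin_le be; have S2 := normr_sin_ge be; have C1 := cos_ge be.
have C2 := cos_le1 be.
have b2E : be ^+ 2 = `|be| ^+ 2 by rewrite real_normK// num_real.
rewrite b2E in S2 C1.
have J2 : `|sin be| * complex.Re z <= s ^+ 2 * Q + `|be| ^+ 2 / 2 * n.
  apply: (@le_trans _ _ `|sin be * complex.Re z|).
    by rewrite normrM ler_wpM2l// ler_norm.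
  rewrite (_ : sin be * _ = (1 - cos be) * complex.Im z -
    ((1 - cos be) * complex.Im z - sin be * complex.Re z)); last by ring.
  apply: le_trans (ler_normB _ _) _; rewrite addrC; apply: lerD => //.
  rewrite normrM; apply: ler_pM => //; rewrite ger0_norm; lra.
have J3 : `|sin be| * (n - s ^+ 2 * (V1 + V2)) <= `|sin be| * complex.Re z.
  exact: ler_wpM2l.
have V0 : 0 <= s ^+ 2 * (V1 + V2) by rewrite mulr_ge0 ?sqr_ge0// addr_ge0.
have J4 := ler_wpM2r V0 S1; have J5 := ler_wpM2r n0 S2.
have s2 : 0 < s ^+ 2 by rewrite exprn_gt0.
rewrite -(ler_pM2l s2).
have J6 : `|be| * n <= s ^+ 2 * Q + 2 * `|be| ^+ 2 * n + `|be| * (s ^+ 2 * (V1 + V2)).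
  have b20' : 0 <= `|be| ^+ 2 * n by rewrite mulr_ge0 ?sqr_ge0.
  move: J2 J3 J4 J5 b20'; rewrite !mulrBr !mulrBl; lra.
rewrite (_ : s ^+ 2 * (`|delta| * n) = `|be| * n); last by rewrite bE; ring.
apply: le_trans J6 _; rewrite le_eqVlt; apply/orP; left; apply/eqP.
by rewrite bE /K; ring.
Qed.

(** An infinite dispersion makes the right side infinite, since both weights are positive; otherwise
    this is the finite case. *)
Lemma lct_uncertainty (h : R -> R[i]) (l : R) :
  b1 != 0 -> b2 != 0 -> cL1 h -> csq h -> 0 < l ->
  (`|delta|%:E * \int[mu]_x (sqmod (h x))%:E <=
   l%:E * \int[mu]_u ((u - m2) ^+ 2 * sqmod (lct a2 b2 d2 h u))%:E +
   l^-1%:E * \int[mu]_u ((u - m1) ^+ 2 * sqmod (lct a1 b1 d1 h u))%:E)%E.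
Proof.
move=> b10 b20 hi h2 l0; have lV : 0 < l^-1 by rewrite invr_gt0.
have F a b d m : (0 <= \int[mu]_u ((u - m) ^+ 2 * sqmod (lct a b d h u))%:E)%E.
  by apply: integral_ge0 => u _; rewrite lee_fin mulr_ge0 ?sqr_ge0 ?sqmod_ge0.
have U := @lct_uncertainty_fin h _ _ l b10 b20 hi h2 l0.
move: (F a1 b1 d1 m1) (F a2 b2 d2 m2) U; rewrite (L1_fineK h2).
case: (\int[mu]_u ((u - m1) ^+ 2 * _)%:E)%E => // [V1 _|_].
  case: (\int[mu]_u ((u - m2) ^+ 2 * _)%:E)%E => // [V2 _|_].
    by move=> /(_ V1 V2 erefl erefl) H; rewrite -!EFinM -EFinD lee_fin.
  by move=> _; rewrite gt0_muley ?lte_fin// addye ?leey.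
move=> V20 _; rewrite [in X in (_ <= _ + X)%E]gt0_muley ?lte_fin//.
rewrite addey ?leey//.
move: V20; case: (\int[mu]_u ((u - m2) ^+ 2 * _)%:E)%E => // _.
by rewrite gt0_muley ?lte_fin.
Qed.

End uncertainty.

(** * Energy and dispersion of the STLCT *)

Section stlct_energy.
Context {R : realType}.
Notation mu := (@lebesgue_measure R).
Notation L1 := (L1 mu).
Variables (f g : R -> R[i]).
Hypotheses (hf : L2 f) (hg : L2 g).

Lemma L2_cL2 (h : R -> R[i]) : L2 h -> cL2 h.
Proof.
move=> [h1 [h2 h3]]; have mh : cmeasurable h by [].
split => //; apply: L1_ge0 => //; first exact: measurable_sqmod.
by move=> x; exact: sqmod_ge0.
Qed.

Let cf : cL2 f. Proof. exact: L2_cL2. Qed.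
Let cg : cL2 g. Proof. exact: L2_cL2. Qed.

Definition windowed (t x : R) : R[i] := f x * (g (x - t))^*.

Lemma cL1_windowed t : cL1 (windowed t).
Proof.
have [mg g2] := cg; apply: (@cL1_cip _ f (fun x => g (x - t))) => //; split.
  by apply: (cmeasurable_comp mg); mfun.
exact: (L1_shift (- t) g2).
Qed.

Lemma cmeasurable_windowed : cmeasurable (fun z : R * R => windowed z.1 z.2).
Proof.
have [mf _] := cf; have [mg _] := cg; apply: cmeasurableM.
  exact: (cmeasurable_comp mf measurable_snd).
by apply: cmeasurableC; apply: (cmeasurable_comp mg); mfun.
Qed.

Lemma sqmod_windowed t x : sqmod (windowed t x) = sqmod (f x) * sqmod (g (x - t)).
Proof. by rewrite /windowed sqmodM sqmodC. Qed.

Lemma measurable_sqmod_windowed :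
  measurable_fun setT (fun z : measurableTypeR R * measurableTypeR R =>
    (sqmod (windowed z.1 z.2))%:E).
Proof. by apply/measurable_EFinP; exact: measurable_sqmod cmeasurable_windowed. Qed.

Definition energy_at (t : R) := (\int[mu]_x (sqmod (windowed t x))%:E)%E.

Lemma energy_at_ge0 t : (0 <= energy_at t)%E.
Proof. by apply: integral_ge0 => x _; rewrite lee_fin sqmod_ge0. Qed.

Lemma measurable_energy_at :
  measurable_fun (setT : set (measurableTypeR R)) energy_at.
Proof.
apply: (@measurable_fun_fubini_tonelli_F _ _ (measurableTypeR R) (measurableTypeR R)
  R mu (fun z => (sqmod (windowed z.1 z.2))%:E)).
  exact: measurable_sqmod_windowed.
by move=> z; rewrite lee_fin sqmod_ge0.
Qed.

(** Tonelli with the time shift integrated first: for fixed x, t runs over all translates of the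
    reflected window, each x receiving the full ||g||^2. *)
Lemma integral_energy_at :
  (\int[mu]_t energy_at t = (sqnorm f * sqnorm g)%:E)%E.
Proof.
have [mf f2] := cf; have [mg g2] := cg.
rewrite (@fubini_tonelli _ _ (measurableTypeR R) (measurableTypeR R) R mu mu
  (fun z => (sqmod (windowed z.1 z.2))%:E) measurable_sqmod_windowed); last first.
  by move=> z; rewrite lee_fin sqmod_ge0.
transitivity (\int[mu]_x ((sqnorm g)%:E * (sqmod (f x))%:E))%E.
  apply: eq_integral => x _ /=.
  under eq_integral do rewrite sqmod_windowed EFinM.
  rewrite ge0_integralZl//.
  - rewrite muleC; congr (_ * _)%E; rewrite /sqnorm -(L1_fineK g2).
    have n1 : (-1 : R) != 0 by rewrite oppr_eq0 oner_eq0.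
    rewrite [RHS](@ge0_integral_affine R x (-1) n1).
    + by rewrite normrN normr1 mul1e; apply: eq_integral => t _; rewrite mulN1r.
    + by apply/measurable_EFinP; exact: measurable_sqmod.
    + by move=> t; rewrite lee_fin sqmod_ge0.
  - apply/measurable_EFinP; apply: (measurableT_comp (measurable_sqmod mg)).
    by mfun.
  - by move=> t _; rewrite lee_fin sqmod_ge0.
  - by rewrite lee_fin sqmod_ge0.
rewrite ge0_integralZl//.
- by rewrite (L1_fineK f2) -EFinM mulrC.
- by apply/measurable_EFinP; exact: measurable_sqmod.
- by move=> t _; rewrite lee_fin sqmod_ge0.
- by rewrite lee_fin sqnorm_ge0.
Qed.

(** A product of two square integrable functions is integrable but may fail to be square integrable.
    Its energy has a finite integral over t, hence is finite for almost every t. *)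
Lemma ae_csq_windowed : {ae mu, forall t, csq (windowed t)}.
Proof.
have I : mu.-integrable setT energy_at.
  apply/integrableP; split; first exact: measurable_energy_at.
  under eq_integral do rewrite gee0_abs ?energy_at_ge0//.
  by rewrite integral_energy_at ltry.
move: (integrable_ae measurableT I); apply: filterS => t /(_ Logic.I) fin.
apply: L1_ge0.
- exact: measurable_sqmod (cL1_cmeasurable (cL1_windowed t)).
- by move=> x; exact: sqmod_ge0.
- by rewrite -ge0_fin_numE// energy_at_ge0.
Qed.

Section one_parameter.
Variables (a b d : R).
Hypothesis b0 : b != 0.

Definition spectrum (z : measurableTypeR R * measurableTypeR R) : R :=
  sqmod (stlct a b d g f z.1 z.2).

Lemma spectrum_ge0 z : 0 <= spectrum z.
Proof. exact: sqmod_ge0. Qed.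

Lemma measurable_spectrum : measurable_fun setT spectrum.
Proof.
apply: measurable_sqmod; apply: (@cmeasurable_cint _ _ _
  (fun y : (measurableTypeR R * measurableTypeR R) * R =>
     windowed y.1.1 y.2 * lct_kernel a b d y.2 y.1.2)).
have m11 : measurable_fun setT
  (fun y : (measurableTypeR R * measurableTypeR R) * R => y.1.1).
  exact: (measurableT_comp measurable_fst measurable_fst).
have m12 : measurable_fun setT
  (fun y : (measurableTypeR R * measurableTypeR R) * R => y.1.2).
  exact: (measurableT_comp measurable_snd measurable_fst).
apply: cmeasurableM; last by apply: cmeasurable_lct_kernel => //; mfun.
apply: (cmeasurable_comp cmeasurable_windowed (phi := fun y => (y.1.1, y.2))).
exact/measurable_fun_pair.
Qed.

Definition dispersion_at (m t : R) :=
  (\int[mu]_u ((u - m) ^+ 2 * sqmod (lct a b d (windowed t) u))%:E)%E.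

Lemma dispersion_at_ge0 m t : (0 <= dispersion_at m t)%E.
Proof.
by apply: integral_ge0 => u _; rewrite lee_fin mulr_ge0 ?sqr_ge0 ?sqmod_ge0.
Qed.

Let measurable_dispersion m : measurable_fun setT
  (fun z : measurableTypeR R * measurableTypeR R => ((z.2 - m) ^+ 2 * spectrum z)%:E).
Proof.
apply/measurable_EFinP; apply: measurable_funM; last exact: measurable_spectrum.
by mfun.
Qed.

Lemma measurable_dispersion_at m :
  measurable_fun (setT : set (measurableTypeR R)) (dispersion_at m).
Proof.
apply: (@measurable_fun_fubini_tonelli_F _ _ (measurableTypeR R) (measurableTypeR R)
  R mu (fun z => ((z.2 - m) ^+ 2 * spectrum z)%:E)) => //.
by move=> z; rewrite lee_fin mulr_ge0 ?sqr_ge0 ?spectrum_ge0.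
Qed.

Lemma integral_dispersion m :
  (\int[(mu \x mu)]_z ((z.2 - m) ^+ 2 * spectrum z)%:E =
   \int[mu]_t dispersion_at m t)%E.
Proof.
rewrite (@fubini_tonelli1 _ _ (measurableTypeR R) (measurableTypeR R) R mu mu
  (fun z => ((z.2 - m) ^+ 2 * spectrum z)%:E))//.
by move=> z; rewrite lee_fin mulr_ge0 ?sqr_ge0 ?spectrum_ge0.
Qed.

(** The orthogonality relation of the STLCT: for almost every t, Plancherel turns the slice at t
    into [energy_at t]. The value does not depend on the matrix. *)
Lemma integral_spectrum :
  (\int[(mu \x mu)]_z (spectrum z)%:E = (sqnorm f * sqnorm g)%:E)%E.
Proof.
have mS : measurable_fun setT (fun z => (spectrum z)%:E).
  by apply/measurable_EFinP; exact: measurable_spectrum.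
have S0 z : (0 <= (spectrum z)%:E)%E by rewrite lee_fin spectrum_ge0.
rewrite (@fubini_tonelli1 _ _ (measurableTypeR R) (measurableTypeR R) R mu mu
  (fun z => (spectrum z)%:E))// -integral_energy_at.
apply: ge0_ae_eq_integral => //.
- exact: (@measurable_fun_fubini_tonelli_F _ _ (measurableTypeR R) (measurableTypeR R)
    R mu (fun z => (spectrum z)%:E)).
- exact: measurable_energy_at.
- by move=> t _; apply: integral_ge0.
- by move=> t _; exact: energy_at_ge0.
- have Fm := ae_filter_ringOfSetsType mu.
  move: ae_csq_windowed; apply: (@filterS _ _ Fm) => t ht _.
  exact: (lct_plancherel a d b0 (cL1_windowed t) ht).
Qed.

Lemma stlct_energyE : stlct_energy a b d g f = sqnorm f * sqnorm g.
Proof. by rewrite /stlct_energy /Rintegral integral_spectrum. Qed.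

(** Positivity prevents a zero dispersion from annihilating an infinite one in the final product. If
    the dispersion were 0, the spectrum would vanish almost everywhere off the line u = m, which is
    null, and the energy would be 0. *)
Lemma dispersion_gt0 m : 0 < sqnorm f * sqnorm g ->
  (0 < \int[(mu \x mu)]_z ((z.2 - m) ^+ 2 * spectrum z)%:E)%E.
Proof.
move=> e0.
have D0 z : (0 <= ((z.2 - m) ^+ 2 * spectrum z)%:E)%E.
  by rewrite lee_fin mulr_ge0 ?sqr_ge0 ?spectrum_ge0.
rewrite lt0e integral_ge0// andbT; apply/eqP => V0.
have : (\int[(mu \x mu)]_z (spectrum z)%:E = 0)%E.
  have : ae_eq (mu \x mu)%E setT (fun z => ((z.2 - m) ^+ 2 * spectrum z)%:E) (cst 0%E).
    apply/ae_eq_integral_abs => //.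
    by under eq_integral do rewrite gee0_abs//.
  move=> D; rewrite -(integral0 (mu \x mu)%E setT).
  apply: ge0_ae_eq_integral => //.
  - by apply/measurable_EFinP; exact: measurable_spectrum.
  - by move=> z _; rewrite lee_fin spectrum_ge0.
  - have N : (mu \x mu)%E.-negligible (setT `*` [set m] : set (R * R)).
      exists (setT `*` [set m]); split => //.
        by apply: measurableX.
      rewrite product_measure1E//; apply/eqP; rewrite mule_eq0; apply/orP; right.
      by apply/eqP; exact: lebesgue_measure_set1.
    have N' : {ae (mu \x mu)%E, forall z : R * R, z.2 != m}.
      apply: negligibleS N => z /= /negP; rewrite negbK => /eqP zm.
      by split.
    move: D N'; apply: filterS2 => z /(_ I) [] /eqP + zm _.
    rewrite mulf_eq0 sqrf_eq0 subr_eq0 (negbTE zm)/= => /eqP ->.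
    by [].
rewrite integral_spectrum => -[] E; by rewrite E ltxx in e0.
Qed.

End one_parameter.

(** The one-signal inequality holds at almost every t with the same [l], [m1] and [m2], so
    integrating it over t involves only linearity and monotonicity. *)
Lemma stlct_uncertainty (a1 b1 d1 m1 a2 b2 d2 m2 l : R) :
  b1 != 0 -> b2 != 0 -> 0 < l ->
  ((`|a1 * b2 - a2 * b1| * (sqnorm f * sqnorm g))%:E <=
   l%:E * \int[(mu \x mu)]_z ((z.2 - m2) ^+ 2 * spectrum a2 b2 d2 z)%:E +
   l^-1%:E * \int[(mu \x mu)]_z ((z.2 - m1) ^+ 2 * spectrum a1 b1 d1 z)%:E)%E.
Proof.
move=> b10 b20 l0; have l1 : 0 < l^-1 by rewrite invr_gt0.
have mE := measurable_energy_at; have E0 := energy_at_ge0.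
have mD1 := measurable_dispersion_at a1 b1 d1 m1.
have mD2 := measurable_dispersion_at a2 b2 d2 m2.
have D10 := dispersion_at_ge0 a1 b1 d1 m1.
have D20 := dispersion_at_ge0 a2 b2 d2 m2.
rewrite !integral_dispersion// EFinM -integral_energy_at.
have U : {ae mu, forall t, setT t -> (`|a1 * b2 - a2 * b1|%:E * energy_at t <=
    l%:E * dispersion_at a2 b2 d2 m2 t + l^-1%:E * dispersion_at a1 b1 d1 m1 t)%E}.
  have Fm := ae_filter_ringOfSetsType mu.
  move: ae_csq_windowed; apply: (@filterS _ _ Fm) => t ht _.
  exact: lct_uncertainty (cL1_windowed t) ht l0.
move: (energy_at) (dispersion_at a1 b1 d1 m1) (dispersion_at a2 b2 d2 m2)
  mE E0 mD1 D10 mD2 D20 U => E D1 D2 mE E0 mD1 D10 mD2 D20 U.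
have Z (k : R) (D : measurableTypeR R -> \bar R) : measurable_fun setT D ->
    (forall t, 0 <= D t)%E -> 0 <= k ->
    (k%:E * \int[mu]_t D t = \int[mu]_t (k%:E * D t))%E.
  by move=> mD D0 k0; rewrite ge0_integralZl// lee_fin.
have l0w := ltW l0; have l1w := ltW l1.
rewrite (Z _ _ mE)// (Z _ _ mD1)// (Z _ _ mD2)//.
rewrite -ge0_integralD//; last 4 first.
- by move=> t _; rewrite mule_ge0// lee_fin ltW.
- exact: emeasurable_funM.
- by move=> t _; rewrite mule_ge0// lee_fin ltW.
- exact: emeasurable_funM.
apply: ae_ge0_le_integral => //.
- by move=> t _; rewrite mule_ge0// lee_fin.
- exact: emeasurable_funM.
- by move=> t _; rewrite adde_ge0// mule_ge0// lee_fin ltW.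
- by apply: emeasurable_funD; exact: emeasurable_funM.
Qed.

End stlct_energy.

(** * Optimization over the weight and conclusion *)

(* Taking l = |r| / (2 y) optimizes the linear bound. *)
Lemma mule_ge_sqr (R : realType) (x y : \bar R) (r : R) :
  (0 < x)%E -> (0 < y)%E ->
  (forall l : R, 0 < l -> (`|r|%:E <= l%:E * y + l^-1%:E * x)%E) ->
  ((r ^+ 2 / 4)%:E <= x * y)%E.
Proof.
case: x => [x| |]; case: y => [y| |] //; rewrite ?lte_fin.
- move=> x0 y0 H; rewrite -EFinM lee_fin -(real_normK (num_real r)).
  have [->|r0] := eqVneq r 0; first by rewrite normr0 expr0n mul0r mulr_ge0// ltW.
  have n0 : 0 < `|r| by rewrite normr_gt0.
  have l0 : 0 < `|r| / (2 * y) by rewrite divr_gt0// mulr_gt0.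
  have := H _ l0; rewrite -!EFinM -EFinD lee_fin.
  have -> : `|r| / (2 * y) * y + (`|r| / (2 * y))^-1 * x = `|r| / 2 + 2 * (x * y) / `|r|.
    by field; rewrite !gt_eqF.
  rewrite -lerBlDl ler_pdivlMr//; rewrite expr2; lra.
- by move=> x0 _ _; rewrite gt0_muley ?leey// lte_fin.
- by move=> _ y0 _; rewrite gt0_mulye ?leey// lte_fin.
- by move=> _ _ _; rewrite mulyy leey.
Qed.

Lemma normalized_mule_ge_sqr (R : realType) (x y : \bar R) (r e : R) :
  0 < e -> (0 < x)%E -> (0 < y)%E ->
  (forall l : R, 0 < l -> ((`|r| * e)%:E <= l%:E * y + l^-1%:E * x)%E) ->
  ((r ^+ 2 / 4)%:E <= (x * e^-1%:E) * (y * e^-1%:E))%E.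
Proof.
move=> e0 x0 y0 H; have e1 : 0 < e^-1 by rewrite invr_gt0.
apply: mule_ge_sqr; [by rewrite mule_gt0// lte_fin|by rewrite mule_gt0// lte_fin|].
move=> l l0; have l1 : 0 < l^-1 by rewrite invr_gt0.
have -> : (`|r|%:E = (`|r| * e)%:E * e^-1%:E)%E by rewrite -EFinM mulfK// gt_eqF.
apply: le_trans (lee_wpmul2r _ (H l l0)) _; first by rewrite lee_fin ltW.
by rewrite ge0_muleDl ?muleA// mule_ge0// ?lee_fin ltW.
Qed.

Theorem theorem2 (R : realType) (a1 b1 c1 d1 a2 b2 c2 d2 : R)
  (hA : a1 * d1 - b1 * c1 = 1) (hB : a2 * d2 - b2 * c2 = 1)
  (hb1 : b1 != 0) (hb2 : b2 != 0)
  (f g : R -> R[i])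
  (hf : L2 f) (hg : L2 g)
  (hf0 : (\int[@lebesgue_measure R]_x (sqmod (f x))%:E != 0)%E)
  (hg0 : (\int[@lebesgue_measure R]_x (sqmod (g x))%:E != 0)%E)
  (hfA : exists F, is_LCT a1 b1 d1 f F /\ L2 (fun u => u%:C * F u))
  (hfB : exists F, is_LCT a2 b2 d2 f F /\ L2 (fun u => u%:C * F u))
  (hgA : exists G, is_LCT a1 b1 d1 g G /\ L2 (fun u => u%:C * G u))
  (hgB : exists G, is_LCT a2 b2 d2 g G /\ L2 (fun u => u%:C * G u)) :
  (stlct_freq_spread a1 b1 d1 g f * stlct_freq_spread a2 b2 d2 g f
     >= (((a1 * b2 - a2 * b1) ^+ 2) / 4)%:E)%E.
Proof.
have sq_gt0 (h : R -> R[i]) : L2 h ->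
    (\int[@lebesgue_measure R]_x (sqmod (h x))%:E != 0)%E -> 0 < sqnorm h.
  move=> /L2_cL2[_ h2]; rewrite (L1_fineK h2) -/(sqnorm h) => h0.
  by rewrite lt_neqAle sqnorm_ge0 andbT eq_sym; apply: contra h0 => /eqP ->.
have e0 : 0 < sqnorm f * sqnorm g by rewrite mulr_gt0// sq_gt0.
(* Both spreads now share the normalization ||f||^2 ||g||^2, and the mean frequencies enter as two
   particular centres. *)
rewrite /stlct_freq_spread !(stlct_energyE hf hg)//.
set m1 := stlct_mean_freq a1 _ _ _ _; set m2 := stlct_mean_freq a2 _ _ _ _.
have U l := @stlct_uncertainty R f g hf hg a1 b1 d1 m1 a2 b2 d2 m2 l hb1 hb2.
have P1 := @dispersion_gt0 R f g hf hg a1 b1 d1 hb1 m1 e0.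
have P2 := @dispersion_gt0 R f g hf hg a2 b2 d2 hb2 m2 e0.
exact: (normalized_mule_ge_sqr e0 P1 P2 U).
Qed.
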